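(* Let $\varepsilon>0$ and $f\in\mathbb R[x]_{2k}$ ($x=(x_1,\dots,x_n)$). Let $f^\star=\inf_{x\in\mathbb R^n}f(x)$ and let $\lambda_k$ be the value of its order-$k$ sum-of-squares relaxation. Suppose there exist $\underline\lambda\in\mathbb R$ and a positive measure $\mu$ on $\mathbb R^n$ such that $\underline\lambda\le\lambda_k$ and $$\frac{\int (f-\underline\lambda)\,d\mu}{\lambda_{\min}(M_k(\mu))}\le 1 .$$ Assume strong duality holds for the order-$k$ primal-dual pair of sum-of-squares and moment relaxations. Let $\lambda_k^{(\varepsilon)}$ be the value returned by the algorithm UNCON (described in the context) run with $\varepsilon$, $\underline\lambda$, and a point $a\in\mathbb R^n$. If $\lambda_k=f^\star$ and the problem $\inf_{x\in\mathbb R^n} f(x)$ has an optimal solution in the $\ell_1$-ball $\{x\in\mathbb R^n:\|x\|_{\ell_1}\le r\}$ for some $r\in(0,1)$, then $$0\le \lambda_k^{(\varepsilon)}-f^\star\le \varepsilon\left(2+\frac{r}{1-r}\right).$$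
   Context: Notation. $\mathbb N^n_t=\{\alpha\in\mathbb N^n:|\alpha|\le t\}$; $\mathbb R[x]_t$ is the space of real polynomials in $n$ variables of degree at most $t$; $f=\sum_\alpha f_\alpha x^\alpha$; $v_k=(x^\alpha)_{\alpha\in\mathbb N^n_k}$; $\mathbb S^N$ (resp. $\mathbb S^N_+$) is the set of real symmetric (resp. positive semidefinite) $N\times N$ matrices. For $y=(y_\alpha)_{\alpha\in\mathbb N^n_{2k}}$: $M_k(y)=(y_{\alpha+\beta})_{\alpha,\beta\in\mathbb N^n_k}$ and $L_y(\sum_\alpha p_\alpha x^\alpha)=\sum_\alpha p_\alpha y_\alpha$. For a measure $\mu$ (with finite moments), $M_k(\mu)=M_k(y)$ with $y_\alpha=\int x^\alpha d\mu$. $\lambda_{\min}(\cdot)$ of a matrix is its smallest eigenvalue (it is implicitly positive in the quotient above). Relaxations. SOS relaxation: $\lambda_k=\sup\{\lambda: \lambda\in\mathbb R,\ G\succeq 0,\ f-\lambda=v_k^\top G v_k\}$. Moment relaxation: $\tau_k=\min\{L_y(f): y=(y_\alpha)_{\alpha\in\mathbb N^n_{2k}},\ M_k(y)\succeq 0,\ y_0=1\}$. Strong duality means $\lambda_k=\tau_k$ and both problems have optimal solutions. Hamiltonian updates HU. Input: $\varepsilon>0$, $A'_1,\dots,A'_{M'}\in\mathbb S^N$, $b'_1,\dots,b'_{M'}\in\mathbb R$ (encoding: find $X\succeq0$ with $\operatorname{tr}X=1$, $\operatorname{tr}(A'_jX)\le b'_j$ for all $j$). Set $W^{(1)}=I_N$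 and $T'=\lceil 16\log(N)/\varepsilon^2\rceil$. For $t=1,\dots,T'$: set $P^{(t)}=W^{(t)}/\operatorname{tr}(W^{(t)})$; if some $j^{(t)}$ satisfies $\operatorname{tr}(A'_{j^{(t)}}P^{(t)})>b'_{j^{(t)}}+\varepsilon$, choose one and set $M^{(t)}=\frac12(I_N-A'_{j^{(t)}})$; otherwise stop with output $\eta=1$. Set $W^{(t+1)}=\exp\big(\frac{\varepsilon}{4}\sum_{s=1}^tM^{(s)}\big)$. If the loop completes, output $\eta=0$. Binary search BS. Input: $C,A_1,\dots,A_M\in\mathbb S^N$, $b\in\mathbb R^M$, reals $\lambda_{\min}<\lambda_{\max}$, $\varepsilon>0$. Set $\underline\lambda_0=\lambda_{\min}$, $\overline\lambda_0=\lambda_{\max}$, $T=\lceil\log_2((\lambda_{\max}-\lambda_{\min})/\varepsilon)\rceil$ (no iterations if $T\le 0$). For $t=0,\dots,T-1$: let $\lambda_t=(\underline\lambda_t+\overline\lambda_t)/2$; run HU with accuracy $\varepsilon$ on the constraints $\operatorname{tr}(A_iX)\le b_i$, $\operatorname{tr}(-A_iX)\le -b_i$ ($i=1,\dots,M$), $\operatorname{tr}(CX)\le\lambda_t$; if $\eta=0$ set $(\underline\lambda_{t+1},\overline\lambda_{t+1})=(\lambda_t,\overline\lambda_t)$, if $\eta=1$ set $(\underline\lambda_{t+1},\overline\lambda_{t+1})=(\underline\lambda_t,\lambda_t)$. Output: the final lower value $\underline\lambda_T$. Algorithm UNCON. For $\gamma\in\mathbb N^n_{2k}$ let $B^{(\gamma)}$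 be the matrix indexed by $\mathbb N^n_k$ with $B^{(\gamma)}_{\alpha,\beta}=1$ if $\alpha+\beta=\gamma$ and $0$ otherwise. Enumerate $\mathbb N^n_{2k}\setminus\{0\}=\{\gamma_1,\dots,\gamma_M\}$, $M=\binom{n+2k}{n}-1$. Put $C=\operatorname{diag}(B^{(0)},0)$, $A_i=\operatorname{diag}(B^{(\gamma_i)},0)$, $b_i=f_{\gamma_i}$, of size $N=\binom{n+k}{n}+1$; $\lambda_{\max}=f_0-\underline\lambda$, $\lambda_{\min}=f_0-f(a)$ (with $\lambda_{\min}<\lambda_{\max}$ as required by BS). Run BS and return $\lambda_k^{(\varepsilon)}=f_0-\underline\lambda_T$. *)

(* Defs.v *)
From HB Require Import structures.
From mathcomp Require Import all_boot all_order all_algebra.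
From mathcomp Require mpoly.
(* The notations of multinomials clash with those of MathComp-Analysis, so they
   are left out and the few that are needed are redeclared below. *)
Import -(notations) mpoly.
From mathcomp Require Import all_classical all_reals all_analysis.
Import numFieldNormedType.Exports.

Set Implicit Arguments.
Unset Strict Implicit.
Unset Printing Implicit Defensive.

Import Order.TTheory GRing.Theory Num.Theory.

Local Open Scope classical_set_scope.
Local Open Scope ring_scope.

Notation "{ 'mpoly' T [ n ] }" := (mpoly.mpoly n T) : type_scope.
Notation "p @_ m" := (mpoly.mcoeff m p)
  (at level 3, m at level 2, left associativity, format "p @_ m") : ring_scope.

(* The multi-indices of N^n_t; a finite type, used to index matrices via
   [enum_val : 'I_#|{: midx n t}| -> midx n t]. *)
Notation midx n t := (mpoly.bmultinom n t.+1).

(* [mpoly.mmeasure mpoly.mdeg f] is 1 plus the degree of f, and 0 for f = 0. *)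
Definition deg_le (R : realType) (n : nat) (f : {mpoly R[n]}) (t : nat) : Prop :=
  (mpoly.mmeasure mpoly.mdeg f <= t.+1)%N.

(* Points of R^n are n-tuples: they carry the product (= Borel) sigma-algebra. *)
Definition pval (R : realType) (n : nat) (f : {mpoly R[n]}) (x : n.-tuple R) : R :=
  mpoly.meval (tnth x) f.

Definition psdmx (R : realType) (N : nat) (A : 'M[R]_N) : Prop :=
  A \is symmetricmx /\ forall u : 'cV[R]_N, 0 <= (u^T *m A *m u) 0 0.

(* The spectrum of a matrix is finite, and nonempty when the matrix is symmetric
   of positive size; for such a matrix the infimum is therefore a minimum. *)
Definition lambda_min (R : realType) (N : nat) (A : 'M[R]_N) : R :=
  inf [set l | eigenvalue A l].

Definition expmx (R : realType) (N : nat) (A : 'M[R]_N) : 'M[R]_N :=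
  limn (series (fun m : nat => (m`!%:R)^-1 *: A ^+ m)).

(* The ceiling as a natural number, negative values being sent to 0. *)
Definition nceil (R : realType) (x : R) : nat :=
  if Num.ceil x is Posz m then m else 0%N.

Section Relaxations.
Variables (R : realType) (n k : nat).

Fact midx_add_subproof (a b : midx n k) :
  (mpoly.mdeg (mpoly.mnm_add a b) < (2 * k).+1)%N.
Proof.
by rewrite mpoly.mdegD ltnS mul2n -addnn leq_add // -ltnS mpoly.bmdeg.
Qed.

Definition midx_add (a b : midx n k) : midx n (2 * k) :=
  mpoly.BMultinom (midx_add_subproof a b).

Definition Bmx (g : midx n (2 * k)) : 'M[R]_#|{: midx n k}| :=
  \matrix_(i, j) (midx_add (enum_val i) (enum_val j) == g)%:R.

Definition moment_mx (y : midx n (2 * k) -> R) : 'M[R]_#|{: midx n k}| :=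
  \matrix_(i, j) y (midx_add (enum_val i) (enum_val j)).

(* Only meaningful for polynomials of degree at most 2k. *)
Definition riesz (y : midx n (2 * k) -> R) (p : {mpoly R[n]}) : R :=
  \sum_(g : midx n (2 * k)) p@_g * y g.

Definition monomials : 'cV[{mpoly R[n]}]_#|{: midx n k}| :=
  \col_i mpoly.mpolyX R (enum_val i : midx n k).

Variable f : {mpoly R[n]}.

Definition sos_feasible (l : R) : Prop :=
  exists2 G : 'M[R]_#|{: midx n k}|, psdmx G &
    f - @mpoly.mpolyC n R l =
      (monomials^T *m map_mx (@mpoly.mpolyC n R) G *m monomials) 0 0.

Definition moment_feasible (y : midx n (2 * k) -> R) : Prop :=
  psdmx (moment_mx y) /\ y mpoly.bm0 = 1.

Definition sos_value : \bar R := ereal_sup [set l%:E | l in sos_feasible].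

Definition moment_value : \bar R :=
  ereal_inf [set (riesz y f)%:E | y in moment_feasible].

Definition strong_duality : Prop :=
  [/\ sos_value = moment_value,
      exists2 l, sos_feasible l & l%:E = sos_value &
      exists2 y, moment_feasible y & (riesz y f)%:E = moment_value].

End Relaxations.

Section Measures.
Variables (R : realType) (n : nat) (mu : {measure set (n.-tuple R) -> \bar R}).

Definition has_moments (t : nat) : Prop :=
  forall g : midx n t,
    mu.-integrable setT (fun x => (pval (mpoly.mpolyX R g) x)%:E).

Definition moment (t : nat) (g : midx n t) : R :=
  \int[mu]_x pval (mpoly.mpolyX R g) x.

Definition measure_moment_mx (k : nat) : 'M[R]_#|{: midx n k}| :=
  moment_mx (moment (t := (2 * k)%N)).

End Measures.

Section Minimization.
Variables (R : realType) (n : nat) (f : {mpoly R[n]}).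

Definition inf_value : \bar R :=
  ereal_inf [set (pval f x)%:E | x in [set: n.-tuple R]].

Definition minimizer (x : n.-tuple R) : Prop :=
  forall z : n.-tuple R, pval f x <= pval f z.

End Minimization.

Section HamiltonianUpdates.
Variables (R : realType) (N : nat) (eps : R).
Variables (I : finType) (A' : I -> 'M[R]_N) (b' : I -> R).

(* [HU_loop m S W eta]: starting an iteration with m iterations left, with
   S the sum of the matrices M^(s) of the previous iterations and W the current
   W^(t), the loop may output eta. It is a relation and not a function because
   any violated constraint may be chosen. *)
Inductive HU_loop : nat -> 'M[R]_N -> 'M[R]_N -> bool -> Prop :=
| HU_complete S W : HU_loop 0 S W false
| HU_stop m S W :
    let P := (\tr W)^-1 *: W in
    (forall j, ~ (\tr (A' j *m P) > b' j + eps)) ->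
    HU_loop m.+1 S W true
| HU_update m S W j eta :
    let P := (\tr W)^-1 *: W in
    let S' := S + 2^-1 *: (1%:M - A' j) in
    \tr (A' j *m P) > b' j + eps ->
    HU_loop m S' (expmx ((eps / 4) *: S')) eta ->
    HU_loop m.+1 S W eta.

Definition HU (eta : bool) : Prop :=
  HU_loop (nceil (16 * ln (N%:R : R) / eps ^+ 2)) 0 1%:M eta.

Lemma HU_total : exists eta, HU eta.
Proof.
rewrite /HU; move: (nceil _) 0 1%:M; elim=> [|m IHm] S W.
  by exists false; constructor.
set P := (\tr W)^-1 *: W.
have [[j Hj]|nHj] := pselect (exists j, \tr (A' j *m P) > b' j + eps).
  have [eta Heta] := IHm (S + 2^-1 *: (1%:M - A' j))
    (expmx ((eps / 4) *: (S + 2^-1 *: (1%:M - A' j)))).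
  by exists eta; apply: HU_update Hj Heta.
by exists true; apply: HU_stop => j Hj; apply: nHj; exists j.
Qed.

End HamiltonianUpdates.

Section BinarySearch.
Variables (R : realType) (N : nat) (eps : R).
Variables (J : finType) (C : 'M[R]_N) (A : J -> 'M[R]_N) (b : J -> R).

Definition BS_lhs (c : J + J + unit) : 'M[R]_N :=
  match c with
  | inl (inl i) => A i
  | inl (inr i) => - A i
  | inr _ => C
  end.

Definition BS_rhs (lam : R) (c : J + J + unit) : R :=
  match c with
  | inl (inl i) => b i
  | inl (inr i) => - b i
  | inr _ => lam
  end.

(* [BS_loop m lo hi out]: with m iterations left and current bounds lo and hi,
   the search may output out. *)
Inductive BS_loop : nat -> R -> R -> R -> Prop :=
| BS_end lo hi : BS_loop 0 lo hi lo
| BS_step m lo hi eta out :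
    let lam := (lo + hi) / 2 in
    HU eps BS_lhs (BS_rhs lam) eta ->
    BS_loop m (if eta then lo else lam) (if eta then lam else hi) out ->
    BS_loop m.+1 lo hi out.

Definition BS (lmin lmax out : R) : Prop :=
  BS_loop (nceil (ln ((lmax - lmin) / eps) / ln 2)) lmin lmax out.

Lemma BS_total lmin lmax : exists out, BS lmin lmax out.
Proof.
rewrite /BS; move: (nceil _) => m; elim: m lmin lmax => [|m IHm] lo hi.
  by exists lo; constructor.
have [eta Heta] := HU_total eps BS_lhs (BS_rhs ((lo + hi) / 2)).
have [out Hout] := IHm (if eta then lo else (lo + hi) / 2)
                       (if eta then (lo + hi) / 2 else hi).
by exists out; apply: BS_step Heta Hout.
Qed.

End BinarySearch.

Section Uncon.
Variables (R : realType) (n k : nat) (f : {mpoly R[n]}).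
Variables (eps lower : R) (a : n.-tuple R).

Definition bordered_Bmx (g : midx n (2 * k)) : 'M[R]_(#|{: midx n k}| + 1) :=
  block_mx (Bmx R g) 0 0 0.

(* The order in which the nonzero multi-indices are enumerated plays no role, so
   they index the constraints directly. *)
Definition nonzero_midx : finType :=
  {g : midx n (2 * k) | g != mpoly.bm0}.

Definition uncon_lmin : R := f@_(@mpoly.mnm0 n) - pval f a.
Definition uncon_lmax : R := f@_(@mpoly.mnm0 n) - lower.

(* [UNCON out]: some run of the algorithm returns out. *)
Definition UNCON (out : R) : Prop :=
  exists2 lo : R,
    BS eps (bordered_Bmx mpoly.bm0)
       (fun g : nonzero_midx => bordered_Bmx (val g))
       (fun g : nonzero_midx => f@_(val g))
       uncon_lmin uncon_lmax lo &
    out = f@_(@mpoly.mnm0 n) - lo.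

End Uncon.

(* Main.v *)
Require Import Defs.
From mathcomp Require Import all_boot all_order all_algebra.
From mathcomp Require mpoly.
From mathcomp Require Import all_classical all_reals all_analysis.
From mathcomp Require Import ring lra.
Import numFieldNormedType.Exports.
Import Order.TTheory GRing.Theory Num.Theory.
Import -(notations) mpoly.
Local Open Scope classical_set_scope.
Local Open Scope ring_scope.

Set Implicit Arguments.
Unset Strict Implicit.
Unset Printing Implicit Defensive.

(* UNCON looks for a positive semidefinite matrix of trace 1 whose upper left
   block G satisfies tr(B_g G) = f_g for g <> 0, while minimising tr(B_0 G); the
   optimal value is f_0 - f*, and for an optimal Gram matrix G one has
   lambda_min(M_k(mu)) tr G <= tr(M_k(mu) G) <= int (f - lower) dmu, so that
   tr G <= 1 and a last diagonal entry 1 - tr G restores trace 1.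
   An answer 0 of Hamiltonian updates certifies infeasibility: otherwise
   Golden-Thompson gives tr W^(t+1) <= tr W^(t) exp((d + d^2) tr(M^(t) P^(t))),
   where d = eps / 4, whereas tr W >= exp(d tr(X sum_s M^(s))) for a feasible X,
   and tr(M^(t) X) exceeds tr(M^(t) P^(t)) by more than eps / 2 at each step;
   this cannot last for 16 log(N) / eps^2 steps.
   Hence the lower value of the search never exceeds f_0 - f*.
   An answer 1 yields P with all constraints satisfied up to eps; evaluating the
   quadratic form of its block G at v_k(x), for a minimiser x, gives
   0 <= lambda + eps + f* - f_0 + eps (sum over g <> 0 of |x^g|), and the last
   sum is at most r / (1 - r).  Hence the upper value of the search never drops
   below f_0 - f* - eps (1 + r / (1 - r)). *)

(** * Quadratic forms and the spectral theorem *)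

Section QuadraticForms.
Variables (R : realType).

Definition qform n (A : 'M[R]_n) (u : 'cV[R]_n) : R := (u^T *m A *m u) 0 0.

(** A bound on the operator norm induced by the sup norm. It behaves well under sums and products,
    and for symmetric matrices it also bounds the quadratic form. *)
Definition row_bound n (A : 'M[R]_n) (c : R) := forall i, \sum_j `|A i j| <= c.

Lemma qformE n (A : 'M[R]_n) u : qform A u = \sum_i \sum_j u i 0 * A i j * u j 0.
Proof.
rewrite /qform mxE exchange_big /=; apply: eq_bigr => j _.
by rewrite mxE mulr_suml; apply: eq_bigr => i _; rewrite !mxE.
Qed.

Lemma qform1 n (u : 'cV[R]_n) : qform 1%:M u = \sum_i u i 0 ^+ 2.
Proof. by rewrite /qform mulmx1 mxE; apply: eq_bigr => i _; rewrite mxE expr2. Qed.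

Lemma qform1_ge0 n (u : 'cV[R]_n) : 0 <= qform 1%:M u.
Proof. by rewrite qform1; apply: sumr_ge0 => i _; exact: sqr_ge0. Qed.

Lemma qform1_gt0 n (u : 'cV[R]_n) : u != 0 -> 0 < qform 1%:M u.
Proof.
move=> u0; rewrite lt_neqAle qform1_ge0 andbT eq_sym; apply: contraNneq u0.
rewrite qform1 => /eqP; rewrite psumr_eq0 => [/allP u0|i _]; last exact: sqr_ge0.
apply/eqP/colP => i; rewrite mxE; apply/eqP.
by rewrite -sqrf_eq0; exact: u0 (mem_index_enum _).
Qed.

Lemma qformD n (A B : 'M[R]_n) u : qform (A + B) u = qform A u + qform B u.
Proof. by rewrite /qform mulmxDr mulmxDl mxE. Qed.

Lemma qformZ n a (A : 'M[R]_n) u : qform (a *: A) u = a * qform A u.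
Proof. by rewrite /qform -scalemxAr -scalemxAl mxE. Qed.

Lemma qformB n (A B : 'M[R]_n) u : qform (A - B) u = qform A u - qform B u.
Proof. by rewrite qformD -scaleN1r qformZ mulN1r. Qed.

Lemma qform_scalar n a (u : 'cV[R]_n) : qform a%:M u = a * qform 1%:M u.
Proof. by rewrite -[a%:M]scalemx1 qformZ. Qed.

(** Each term satisfies [|u_i A_ij u_j| <= |A_ij| (u_i^2 + u_j^2) / 2]; by symmetry both halves sum
    to row sums. *)
Lemma qform_row_bound n (A : 'M[R]_n) c u :
  A^T = A -> row_bound A c -> `|qform A u| <= c * qform 1%:M u.
Proof.
move=> sA bA; rewrite qformE qform1.
have step : forall i j, `|u i 0 * A i j * u j 0| <=
    2^-1 * (`|A i j| * u i 0 ^+ 2) + 2^-1 * (`|A j i| * u j 0 ^+ 2).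
  move=> i j; have -> : A j i = A i j by rewrite -[in RHS]sA mxE.
  rewrite !normrM -[u i 0 ^+ 2](real_normK (num_real _)).
  rewrite -[u j 0 ^+ 2](real_normK (num_real _)).
  have := normr_ge0 (A i j).
  move: `|u i 0| `|u j 0| `|A i j| => x y a a0.
  rewrite -subr_ge0.
  have -> : 2^-1 * (a * x ^+ 2) + 2^-1 * (a * y ^+ 2) - x * a * y
     = 2^-1 * (a * (x - y) ^+ 2).
    by field.
  by apply: mulr_ge0; rewrite ?invr_ge0 //; apply: mulr_ge0 => //; exact: sqr_ge0.
apply: (le_trans (ler_norm_sum _ _ _)).
have -> : c * (\sum_i u i 0 ^+ 2) =
   2^-1 * (\sum_i c * u i 0 ^+ 2) + 2^-1 * (\sum_i c * u i 0 ^+ 2).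
  by rewrite -mulr_sumr; field.
have half : \sum_i \sum_j `|A i j| * u i 0 ^+ 2 <= \sum_i c * u i 0 ^+ 2.
  apply: ler_sum => i _; rewrite -mulr_suml ler_wpM2r ?sqr_ge0 //; exact: bA.
apply: (@le_trans _ _ (\sum_i \sum_j
    (2^-1 * (`|A i j| * u i 0 ^+ 2) + 2^-1 * (`|A j i| * u j 0 ^+ 2)))).
  apply: ler_sum => i _; apply: (le_trans (ler_norm_sum _ _ _)).
  by apply: ler_sum => j _; exact: step.
under eq_bigr do rewrite big_split /=.
rewrite big_split /= lerD //.
  by under eq_bigr do rewrite -mulr_sumr; rewrite -mulr_sumr ler_pM2l.
rewrite exchange_big /=.
by under eq_bigr do rewrite -mulr_sumr; rewrite -mulr_sumr ler_pM2l.
Qed.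

Lemma row_bound_exists n (A : 'M[R]_n) : {c : R | 0 < c & row_bound A c}.
Proof.
exists (1 + \sum_i \sum_j `|A i j|).
  by rewrite ltr_pwDl // !sumr_ge0 // => i _; rewrite sumr_ge0.
move=> i; rewrite [leRHS](_ : _ = \sum_j `|A i j| +
    (1 + \sum_(k | k != i) \sum_j `|A k j|)); last by rewrite (bigD1 i) //= addrCA.
by rewrite lerDl addr_ge0 // sumr_ge0 // => j _; rewrite sumr_ge0.
Qed.

Lemma qform_sub n (A : 'M[R]_n) u v : A^T = A ->
  qform A (u - v) = qform A u - 2 * (u^T *m (A *m v)) 0 0 + (v^T *m (A *m v)) 0 0.
Proof.
move=> sA; have cross : (v^T *m (A *m u)) 0 0 = (u^T *m (A *m v)) 0 0.
  have <- : (v^T *m (A *m u))^T = u^T *m (A *m v).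
    by rewrite !trmx_mul trmxK sA mulmxA.
  by rewrite [RHS]mxE.
have mxB (X Y : 'M[R]_1) : (X - Y) 0 0 = X 0 0 - Y 0 0 by rewrite !mxE.
rewrite /qform -!mulmxA mulmxBr [(u - v)^T]linearB /= mulmxBl !mulmxBr !mxB cross; ring.
Qed.

(** Evaluating the form of [B] at [u - C^-1 B^-1 u], where [C] bounds the form of [B^-1], gives [0
    <= q_B(u) - 2 |u|^2 / C + q_(B^-1)(u) / C^2 <= q_B(u) - |u|^2 / C]. *)
Lemma psd_shift_of_unit n (B : 'M[R]_n) : B^T = B -> B \in unitmx ->
  (forall u, 0 <= qform B u) -> exists2 c, 0 < c & forall u, 0 <= qform (B - c%:M) u.
Proof.
move=> sB uB pB; have [C C0 bC] := row_bound_exists (invmx B).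
exists C^-1; first by rewrite invr_gt0.
move=> u; rewrite qformB qform_scalar.
have sI : (invmx B)^T = invmx B by rewrite trmx_inv sB.
have := ler_norml (qform (invmx B) u) (C * qform 1%:M u).
rewrite qform_row_bound // => /esym/andP[_ hI].
have := pB (u - C^-1 *: (invmx B *m u)).
have -> : qform B (u - C^-1 *: (invmx B *m u)) =
  qform B u - 2 * C^-1 * qform 1%:M u + C^-1 ^+ 2 * qform (invmx B) u.
  rewrite qform_sub // -scalemxAr mulKVmx // [(_ *: _)^T]linearZ /=.
  rewrite trmx_mul sI -scalemxAl -!scalemxAr -!mulmxA /qform !mulmxA !mulmx1 !mxE; ring.
move=> h; apply: (le_trans h); rewrite -subr_ge0.
have -> : qform B u - C^-1 * qform 1%:M u - (qform B u - 2 * C^-1 * qform 1%:M u +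
   C^-1 ^+ 2 * qform (invmx B) u) =
   C^-1 ^+ 2 * (C * qform 1%:M u - qform (invmx B) u).
  by field; rewrite gt_eqF.
by rewrite mulr_ge0 ?sqr_ge0 // subr_ge0.
Qed.
End QuadraticForms.

Section SpectralTheorem.
Variables (R : realType).

(** Let [l] be the supremum of the numbers for which [A - l] is positive semidefinite. The supremum
    is attained; were [A - l] invertible, it could be shifted further down, so it is singular and a
    kernel vector is an eigenvector. *)
Lemma symmetric_eigenvector n (A : 'M[R]_n.+1) : A^T = A ->
  exists l, exists2 u : 'cV[R]_n.+1, u != 0 & A *m u = l *: u.
Proof.
move=> sA; pose E := [set l : R | forall u, 0 <= qform (A - l%:M) u].
have EP l : E l <-> forall u, l * qform 1%:M u <= qform A u.
  by split=> h u; have := h u; rewrite qformB qform_scalar subr_ge0.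
have [c c0 bc] := row_bound_exists A.
have E0 : E !=set0.
  exists (- c); apply/EP => u; rewrite mulNr.
  have := ler_norml (qform A u) (c * qform 1%:M u).
  by rewrite qform_row_bound // => /esym/andP[].
have ubE (u : 'cV_n.+1) : u != 0 -> ubound E (qform A u / qform 1%:M u).
  by move=> u0 l /EP/(_ u) h; rewrite ler_pdivlMr ?qform1_gt0.
have e0 : delta_mx 0 0 != 0 :> 'cV[R]_n.+1.
  by apply/eqP => /matrixP/(_ 0 0); rewrite !mxE /= => /eqP; rewrite oner_eq0.
have supE : has_sup E.
  split=> //; exists (qform A (delta_mx 0 0) / qform 1%:M (delta_mx 0 0 : 'cV_n.+1)).
  exact: ubE.
pose l := sup E; pose B := A - l%:M.
have El : E l.
  apply/EP => u; have [->|u0] := eqVneq u 0.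
    by rewrite /qform !mulmx0 mxE mulr0.
  by rewrite -ler_pdivlMr ?qform1_gt0 // ge_sup //; exact: ubE.
have sB : B^T = B by rewrite /B linearB /= tr_scalar_mx sA.
have nB : B \notin unitmx.
  apply/negP => uB; have [d d0 hd] := psd_shift_of_unit sB uB El.
  have : E (l + d).
    by move=> u; have := hd u; rewrite /B raddfD /= opprD addrA.
  by move/(ub_le_sup supE.2); rewrite gerDl leNgt d0.
move: nB; rewrite unitmxE unitfE negbK => /det0P[v v0 vB].
exists l, v^T; first by rewrite trmx_eq0.
have : (v *m B)^T = 0 by rewrite vB trmx0.
rewrite trmx_mul sB /B mulmxBl mul_scalar_mx => /eqP.
by rewrite subr_eq0 => /eqP.
Qed.

(* The Householder reflection exchanging the first basis vector and u. *)
Lemma unit_vector_reflection n (u : 'cV[R]_n.+1) : qform 1%:M u = 1 ->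
  exists H : 'M[R]_n.+1, [/\ H^T = H, H *m H = 1%:M & H *m delta_mx 0 0 = u].
Proof.
move=> u1; pose e : 'cV[R]_n.+1 := delta_mx 0 0.
have [ue|ue] := eqVneq u e.
  by exists 1%:M; rewrite trmx1 !mul1mx.
pose w := u - e; pose q := qform 1%:M w.
have q0 : 0 < q by apply: qform1_gt0; rewrite subr_eq0.
have ww : w^T *m w = q%:M.
  by rewrite [LHS]mx11_scalar /q /qform mulmx1.
have ee : e^T *m e = 1%:M.
  by rewrite trmx_delta mul_delta_mx; apply/matrixP => i j; rewrite !mxE !ord1.
have uu : u^T *m u = 1%:M.
  by rewrite [LHS]mx11_scalar -u1 /qform mulmx1.
pose s := (u^T *m e) 0 0.
have ues : u^T *m e = s%:M by rewrite [LHS]mx11_scalar.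
have eus : e^T *m u = s%:M.
  by rewrite -[LHS]trmxK trmx_mul trmxK ues tr_scalar_mx.
have we : w^T *m e = (s - 1)%:M.
  by rewrite /w linearB /= mulmxBl ues ee raddfB.
have qs : q = 2 - 2 * s.
  have : w^T *m w = (2 - 2 * s)%:M.
    rewrite {2}/w mulmxBr we /w linearB /= mulmxBl uu eus -!raddfB /=.
    by congr (_%:M); ring.
  by rewrite ww => /matrixP/(_ 0 0); rewrite !mxE eqxx !mulr1n.
exists (1%:M - (2 / q) *: (w *m w^T)); split.
- by rewrite linearB /= linearZ /= trmx1 trmx_mul trmxK.
- have XX : w *m w^T *m (w *m w^T) = q *: (w *m w^T).
    by rewrite mulmxA -(mulmxA w) ww mul_mx_scalar -scalemxAl.
  move: (w *m w^T) XX => X XX.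
  rewrite mulmxBl mul1mx mulmxBr mulmx1 -scalemxAl -scalemxAr XX.
  by apply/matrixP => i j; rewrite !mxE; field; rewrite gt_eqF.
- rewrite mulmxBl mul1mx -scalemxAl -mulmxA -/e we mul_mx_scalar scalerA.
  have -> : 2 / q * (s - 1) = -1.
    have -> : s - 1 = - q / 2 by rewrite qs; field.
    by field; rewrite gt_eqF.
  by rewrite scaleN1r opprK addrC subrK.
Qed.

(** Deflation: conjugating by a reflection that sends the first basis vector to a unit eigenvector
    makes [A] block diagonal, by symmetry, and the induction hypothesis diagonalises the remaining
    block. *)
Lemma symmetric_spectral n (A : 'M[R]_n) : A^T = A ->
  exists (P : 'M[R]_n) d, P *m P^T = 1%:M /\ A = P^T *m diag_mx d *m P.
Proof.
elim: n A => [|n IHn] A sA.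
  by exists 1%:M, 0; rewrite trmx1 mulmx1; split => //; rewrite !flatmx0.
have [l [u0 u00 Au0]] := symmetric_eigenvector sA.
pose c := Num.sqrt (qform 1%:M u0); pose u := c^-1 *: u0.
have c0 : 0 < c by rewrite sqrtr_gt0 qform1_gt0.
have u1 : qform 1%:M u = 1.
  rewrite /qform /u [(_ *: _)^T]linearZ /= mulmx1 -scalemxAl -scalemxAr scalerA mxE.
  have -> : (u0^T *m u0) 0 0 = c ^+ 2.
    by rewrite sqr_sqrtr ?qform1_ge0 // /qform mulmx1.
  by field; rewrite gt_eqF.
have Au : A *m u = l *: u by rewrite /u -scalemxAr Au0 !scalerA mulrC.
have [H [sH HH He]] := unit_vector_reflection u1.
pose Ap : 'M[R]_(1 + n) := H *m A *m H.
have sAp : Ap^T = Ap by rewrite !trmx_mul sH sA mulmxA.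
have Ape : Ap *m delta_mx 0 0 = l *: delta_mx 0 0 :> 'cV[R]_(1 + n).
  by rewrite /Ap -!mulmxA He Au -He -scalemxAr mulmxA HH mul1mx.
have AH : A = H *m Ap *m H.
  by rewrite /Ap !mulmxA HH mul1mx -mulmxA HH mulmx1.
clearbody Ap.
(* The column is given by its value, so that the equation also applies to indices produced by the
   block decomposition. *)
have col0 i (j : 'I_(1 + n)) : j = 0 :> nat -> Ap i j = l * ((i : nat) == 0)%:R.
  move=> j0; have -> : j = ord0 by apply/val_inj.
  have := congr1 (fun M : 'cV[R]_(1 + n) => M i 0) Ape.
  by rewrite -colE !mxE eqxx andbT.
pose B := drsubmx Ap.
have ApB : Ap = block_mx l%:M 0 0 B.
  have dl0 : dlsubmx Ap = 0.
    by apply/matrixP => i j; rewrite !mxE col0 /= ?ord1 // mulr0.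
  rewrite -[LHS]submxK dl0; congr block_mx.
    by apply/matrixP => i j; rewrite !ord1 !mxE col0 //= mulr1.
  by rewrite -sAp -trmx_dlsub dl0 trmx0.
have sB : B^T = B by rewrite /B trmx_drsub sAp.
have [Q [d [QQ Bd]]] := IHn _ sB.
pose K : 'M[R]_(1 + n) := block_mx 1%:M 0 0 Q.
have KT : K^T = block_mx 1%:M 0 0 Q^T.
  by rewrite /K tr_block_mx !trmx0 trmx1.
have KK : K *m K^T = 1%:M.
  rewrite KT /K mulmx_block !mulmx0 !mul0mx !addr0 !add0r mul1mx QQ.
  by rewrite -scalar_mx_block.
have KD : Ap = K^T *m diag_mx (row_mx l%:M d) *m K.
  rewrite ApB KT /K diag_mx_row !mulmx_block !mulmx0 !mul0mx !addr0 !add0r.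
  rewrite ?mulmx0 ?mul0mx mul1mx mulmx1 Bd; congr block_mx.
  by apply/matrixP => i j; rewrite !ord1 !mxE.
exists (K *m H), (row_mx l%:M d); split.
  rewrite trmx_mul sH mulmxA -(mulmxA K) HH mulmx1; exact: KK.
by rewrite trmx_mul sH AH KD !mulmxA.
Qed.

End SpectralTheorem.

(** * Matrix exponential *)

Section MatrixExponential.
Variables (R : realType) (n : nat).

(** For orthogonal [P], whose rows are then eigenvectors, this is a functional calculus: with [P]
    fixed, sums, products, powers and exponentials act entrywise on [d]. *)
Definition spec_mx (P : 'M[R]_n) (d : 'rV[R]_n) : 'M[R]_n :=
  P^T *m diag_mx d *m P.

Lemma cvg_sum_seq (I : finType) (f : I -> nat -> R) (l : I -> R) :
  (forall i, f i @ \oo --> l i) -> \sum_i f i k @[k --> \oo] --> \sum_i l i.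
Proof.
move=> fl; apply: (@cvg_big _ _ +%R 0 predT (@add_continuous R^o) _ _ _ f l) => i _.
exact: fl.
Qed.

Lemma cvg_mx_entries (U : nat -> 'M[R]_n) (L : 'M[R]_n) :
  (forall i j, U k i j @[k --> \oo] --> L i j) -> U @ \oo --> L.
Proof.
move=> UL; apply/cvg_ballP => e e0.
have : \forall k \near \oo, forall i j, ball (L i j) e (U k i j).
  apply: filter_forall => i; apply: filter_forall => j.
  by have /cvg_ballP/(_ _ e0) := UL i j.
by apply: filterS => k h; split.
Qed.

Lemma spec_mxE P d i j : spec_mx P d i j = \sum_k P k i * d 0 k * P k j.
Proof. by rewrite mxE; apply: eq_bigr => k _; rewrite mul_mx_diag !mxE. Qed.

Lemma tr_spec_mx P d : (spec_mx P d)^T = spec_mx P d.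
Proof. by rewrite /spec_mx !trmx_mul trmxK tr_diag_mx mulmxA. Qed.

(** Reduces trace inequalities to scalar inequalities between eigenvalues, weighted by the form of
    [W] at the eigenvectors. *)
Lemma mxtrace_mul_spec (W P : 'M[R]_n) d :
  \tr (W *m spec_mx P d) = \sum_i d 0 i * qform W (row i P)^T.
Proof.
rewrite /spec_mx !mulmxA mxtrace_mulC !mulmxA /mxtrace; apply: eq_bigr => i _.
by rewrite mul_mx_diag mxE mulrC /qform trmxK -row_mul [in RHS]mxE !mxE;
  congr (_ * _); apply: eq_bigr => k _; rewrite !mxE.
Qed.

Section Orthogonal.
Variable P : 'M[R]_n.
Hypothesis PP : P *m P^T = 1%:M.

Lemma spec_mx_cst a : spec_mx P (const_mx a) = a%:M.
Proof.
by rewrite /spec_mx diag_const_mx mul_mx_scalar -scalemxAl (mulmx1C PP) scalemx1.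
Qed.

Lemma spec_mxD d d' : spec_mx P d + spec_mx P d' = spec_mx P (d + d').
Proof. by rewrite /spec_mx raddfD /= mulmxDr mulmxDl. Qed.

Lemma spec_mxZ a d : a *: spec_mx P d = spec_mx P (a *: d).
Proof. by rewrite /spec_mx linearZ /= -scalemxAr -scalemxAl. Qed.

Lemma spec_mxM d d' :
  spec_mx P d *m spec_mx P d' = spec_mx P (\row_i (d 0 i * d' 0 i)).
Proof.
rewrite /spec_mx !mulmxA -(mulmxA _ P) PP mulmx1 -(mulmxA P^T) mulmx_diag.
by do 3 f_equal; apply/rowP => i; rewrite !mxE.
Qed.

Lemma spec_mxX d k : spec_mx P d ^+ k = spec_mx P (map_mx (fun x => x ^+ k) d).
Proof.
elim: k => [|k IHk].
  rewrite expr0 -[LHS](spec_mx_cst 1); congr spec_mx.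
  by apply/rowP => i; rewrite !mxE expr0.
rewrite exprS IHk -[LHS]/(_ *m _) spec_mxM; congr spec_mx.
by apply/rowP => i; rewrite !mxE exprS.
Qed.


Lemma sum_qform_row (W : 'M[R]_n) : \sum_i qform W (row i P)^T = \tr W.
Proof.
rewrite -[in RHS](mulmx1 W) -(spec_mx_cst 1) mxtrace_mul_spec.
by apply: eq_bigr => i _; rewrite mxE mul1r.
Qed.

Lemma mxtrace_spec d : \tr (spec_mx P d) = \sum_i d 0 i.
Proof.
by rewrite /spec_mx mxtrace_mulC mulmxA PP mul1mx mxtrace_diag.
Qed.

Lemma eigen_spec_row d i : row i P *m spec_mx P d = d 0 i *: row i P.
Proof.
rewrite -row_mul /spec_mx !mulmxA PP mul1mx; apply/rowP => j.
by rewrite mul_diag_mx !mxE.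
Qed.

Lemma qform1_row i : qform 1%:M (row i P)^T = 1.
Proof.
rewrite /qform trmxK mulmx1 mxE.
have := congr1 (fun M : 'M[R]_n => M i i) PP; rewrite !mxE eqxx => h; apply: etrans h.
by apply: eq_bigr => k _; rewrite !mxE.
Qed.

Lemma qform_spec_row d i : qform (spec_mx P d) (row i P)^T = d 0 i.
Proof.
rewrite /qform trmxK eigen_spec_row -scalemxAl mxE.
by have := qform1_row i; rewrite /qform trmxK mulmx1 => ->; rewrite mulr1.
Qed.

Lemma qform_spec_ge0 (d : 'rV[R]_n) u : (forall i, 0 <= d 0 i) ->
  0 <= qform (spec_mx P d) u.
Proof.
move=> d0; rewrite /qform /spec_mx !mulmxA -mulmxA -trmx_mul mxE.
apply: sumr_ge0 => k _; rewrite mul_mx_diag !mxE mulrAC mulr_ge0 //.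
exact: sqr_ge0.
Qed.

(** All partial sums are diagonal in the same basis, so each entry is a finite combination of scalar
    exponential series. *)
Lemma expmx_spec d : expmx (spec_mx P d) = spec_mx P (map_mx (@expR R) d).
Proof.
apply: cvg_lim; first exact: norm_hausdorff.
apply: cvg_mx_entries => i j; rewrite spec_mxE.
have -> : (fun k => series (fun m : nat => (m`!%:R)^-1 *: spec_mx P d ^+ m) k i j) =
   (fun k => \sum_l (P l i * series (exp_coeff (d 0 l)) k * P l j)).
  apply/funext => k; rewrite /series /= summxE.
  under [LHS]eq_bigr do rewrite mxE spec_mxX spec_mxE mulr_sumr.
  rewrite exchange_big /=; apply: eq_bigr => l _.
  rewrite mulr_sumr mulr_suml; apply: eq_bigr => m _.
  by rewrite mxE /exp_coeff /=; ring.
apply: cvg_sum_seq => l; rewrite mxE.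
apply: cvgM; last exact: cvg_cst.
apply: cvgM; first exact: cvg_cst.
exact: is_cvg_series_exp_coeff.
Qed.

End Orthogonal.
End MatrixExponential.

(** * The Golden-Thompson inequality *)

Section GoldenThompson.
Variables (R : realType) (n : nat).
Implicit Types A B X Y Z : 'M[R]_n.

Lemma mxtrace_sym_sqr_ge0 A : 0 <= \tr (A * A^T).
Proof.
rewrite /mxtrace; apply: sumr_ge0 => i _; rewrite mxE; apply: sumr_ge0 => j _.
by rewrite mxE; exact: sqr_ge0.
Qed.

(** The difference of the two sides is half the squared Frobenius norm of [Z - Z^T]. *)
Lemma mxtrace_sqr_le Z : \tr (Z ^+ 2) <= \tr (Z * Z^T).
Proof.
have := mxtrace_sym_sqr_ge0 (Z - Z^T).
rewrite linearB /= trmxK mulrBl !mulrBr !linearB /=.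
have -> : \tr (Z^T * Z^T) = \tr (Z ^+ 2).
  by rewrite -[LHS]mxtrace_tr trmx_mul !trmxK.
rewrite [\tr (Z^T * Z)]mxtrace_mulC expr2 -[Z *m Z^T]/(Z * Z^T); lra.
Qed.

Lemma mxtrace_mul_sym_le A B : A^T = A -> B^T = B ->
  \tr (A * B) <= (\tr (A ^+ 2) + \tr (B ^+ 2)) / 2.
Proof.
move=> sA sB; have := mxtrace_sym_sqr_ge0 (A - B).
rewrite linearB /= sA sB mulrBl !mulrBr !linearB /= !expr2.
rewrite [\tr (B * A)]mxtrace_mulC -[A *m B]/(A * B); lra.
Qed.

Lemma expr_mulC A B m : (A * B) ^+ m * A = A * (B * A) ^+ m.
Proof.
elim: m => [|m IHm]; first by rewrite !expr0 mul1r mulr1.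
by rewrite exprS -mulrA IHm exprS !mulrA.
Qed.

Lemma mxtrace_exprC A B m : \tr ((A * B) ^+ m) = \tr ((B * A) ^+ m).
Proof.
case: m => [|m]; first by rewrite !expr0.
rewrite exprSr mulrA expr_mulC [LHS]mxtrace_mulC.
by rewrite -[B *m _]/(B * _) mulrA -exprS.
Qed.

Lemma tr_expr A m : (A ^+ m)^T = A^T ^+ m.
Proof.
elim: m => [|m IHm]; first by rewrite !expr0 trmx1.
by rewrite exprS trmx_mul IHm exprSr.
Qed.

(* The two inequalities are proved together because each induction step uses both. *)
Lemma mxtrace_expr_mul_le j :
  (forall Z, \tr (Z ^+ (2 ^ j.+1)) <= \tr ((Z * Z^T) ^+ (2 ^ j))) /\
  (forall X Y, X^T = X -> Y^T = Y ->
     \tr ((X * Y) ^+ (2 ^ j)) <= \tr (X ^+ (2 ^ j) * Y ^+ (2 ^ j))).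
Proof.
have trM (A B : 'M[R]_n) : (A * B)^T = B^T * A^T := trmx_mul A B.
elim: j => [|j [IHZ IHXY]].
  by split=> [Z|X Y _ _]; rewrite ?expr1 // mxtrace_sqr_le.
split=> [Z|X Y sX sY].
  (* Apply the first hypothesis to [Z^2], regroup cyclically into powers of [(Z Z^T)(Z^T Z)], and
     separate the factors by the second hypothesis; the squares of the two resulting powers have
     equal traces. *)
  have sL : (Z^T * Z)^T = Z^T * Z by rewrite trmx_mul trmxK.
  have sR : (Z * Z^T)^T = Z * Z^T by rewrite trmx_mul trmxK.
  rewrite (expnS 2 j.+1) exprM; apply: (le_trans (IHZ _)).
  have -> : \tr ((Z ^+ 2 * (Z ^+ 2)^T) ^+ (2 ^ j)) =
      \tr ((Z * Z^T * (Z^T * Z)) ^+ (2 ^ j)).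
    by rewrite expr2 trM -mulrA mxtrace_exprC !mulrA.
  apply: (le_trans (IHXY _ _ sR sL)).
  apply: (le_trans (mxtrace_mul_sym_le _ _)); rewrite ?tr_expr ?sL ?sR //.
  by rewrite -!exprM -expnSr [\tr ((Z^T * Z) ^+ _)]mxtrace_exprC; lra.
(* For [Z = X Y], the product [Z Z^T = X Y Y X] is cyclically [X^2 Y^2], to which the second
   hypothesis applies. *)
apply: (le_trans (IHZ _)).
have -> : \tr ((X * Y * (X * Y)^T) ^+ (2 ^ j)) = \tr ((X ^+ 2 * Y ^+ 2) ^+ (2 ^ j)).
  rewrite trM sX sY -mulrA mxtrace_exprC [X ^+ 2]expr2 [Y ^+ 2]expr2 -!mulrA.
  by rewrite [Y * (Y * _)]mulrA [X * (X * (Y * Y))]mulrA [LHS]mxtrace_exprC.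
by rewrite expnS !exprM; apply: IHXY; rewrite tr_expr ?sX ?sY.
Qed.

Lemma row_boundM A B a b : row_bound A a -> row_bound B b -> 0 <= b ->
  row_bound (A * B) (a * b).
Proof.
move=> hA hB b0 i; apply: (@le_trans _ _ (\sum_j \sum_k `|A i k| * `|B k j|)).
  apply: ler_sum => j _; rewrite mxE; apply: (le_trans (ler_norm_sum _ _ _)).
  by apply: ler_sum => k _; rewrite normrM.
rewrite exchange_big /=; apply: (@le_trans _ _ (\sum_k `|A i k| * b)).
  by apply: ler_sum => k _; rewrite -mulr_sumr ler_wpM2l.
by rewrite -mulr_suml ler_wpM2r.
Qed.

Lemma row_boundD A B a b : row_bound A a -> row_bound B b ->
  row_bound (A + B) (a + b).
Proof.
move=> hA hB i; apply: le_trans (lerD (hA i) (hB i)); rewrite -big_split /=.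
by apply: ler_sum => j _; rewrite mxE ler_normD.
Qed.

Lemma row_boundZ A a c : row_bound A a -> row_bound (c *: A) (`|c| * a).
Proof.
move=> hA i; under eq_bigr do rewrite mxE normrM.
by rewrite -mulr_sumr ler_wpM2l.
Qed.

Lemma row_bound1 : row_bound (1 : 'M[R]_n) 1.
Proof.
move=> i; rewrite (bigD1 i) //= mxE eqxx normr1 big1 ?addr0 // => j /negPf ji.
by rewrite mxE eq_sym ji normr0.
Qed.

Lemma row_bound_le A a b : row_bound A a -> a <= b -> row_bound A b.
Proof. by move=> hA ab i; exact: le_trans (hA i) ab. Qed.

Lemma row_bound_entry A a i j : row_bound A a -> `|A i j| <= a.
Proof.
by move=> /(_ i); apply: le_trans; rewrite (bigD1 j) //= lerDl sumr_ge0.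
Qed.

Lemma row_boundX A a m : row_bound A a -> 0 <= a -> row_bound (A ^+ m) (a ^+ m).
Proof.
move=> hA a0; elim: m => [|m IHm]; first exact: row_bound1.
by rewrite !exprS; apply: row_boundM => //; exact: exprn_ge0.
Qed.

(** By induction on [X^(m+1) - Y^(m+1) = X (X^m - Y^m) + (X - Y) Y^m]; since [1 <= q], the exponent
    [m] can stand for [m - 1]. *)
Lemma row_bound_subX X Y q e m : row_bound X q -> row_bound Y q ->
  row_bound (X - Y) e -> 1 <= q -> 0 <= e ->
  row_bound (X ^+ m - Y ^+ m) (m%:R * e * q ^+ m).
Proof.
move=> hX hY hXY q1 e0; have q0 : 0 <= q := le_trans ler01 q1.
elim: m => [|m IHm].
  by rewrite !expr0 subrr !mul0r => i; rewrite big1 // => j _; rewrite mxE normr0.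
have -> : X ^+ m.+1 - Y ^+ m.+1 = X * (X ^+ m - Y ^+ m) + (X - Y) * Y ^+ m.
  by rewrite !exprS mulrBr mulrBl addrA subrK.
apply: (@row_bound_le _ (q * (m%:R * e * q ^+ m) + e * q ^+ m)).
  apply: row_boundD; apply: row_boundM => //; rewrite ?mulr_ge0 ?exprn_ge0 //.
  exact: row_boundX.
rewrite -natr1 exprS !mulrDl mul1r lerD //.
  by rewrite le_eqVlt; apply/orP; left; apply/eqP; ring.
by rewrite ler_wpM2l // ler_peMl // exprn_ge0.
Qed.

End GoldenThompson.

(** * Limits and bounds for the scalar exponential *)

Section ExpLimits.
Variable R : realType.

Lemma cvg_half_expn : (2^-1 : R) ^+ k @[k --> \oo] --> 0.
Proof.
have -> : (fun k => (2^-1 : R) ^+ k) = geometric 1 2^-1.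
  by apply/funext => k; rewrite /geometric /= mul1r.
by apply: cvg_geometric; rewrite ger0_norm ?invr_ge0 // invf_lt1 // ltr1n.
Qed.

Lemma half_expn_mul k : (2 ^ k)%:R * (2^-1 : R) ^+ k = 1.
Proof. by rewrite natrX -exprMn divff ?expr1n // pnatr_eq0. Qed.

(** With [h = 2^-k], the inequality [1 + y <= exp y] at [y = h x] and at [y = - h x / (1 + h x)]
    squeezes the power between [exp (x / (1 + h x))] and [exp x], once [1 + h x] is positive. *)
Lemma cvg_compound (x : R) :
  (1 + 2^-1 ^+ k * x) ^+ (2 ^ k) @[k --> \oo] --> expR x.
Proof.
have h0 : (1 : R) + 2^-1 ^+ k * x @[k --> \oo] --> (1 : R).
  rewrite -[X in _ --> X]addr0 -(mul0r x); apply: cvgD; first exact: cvg_cst.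
  by apply: cvgM; [exact: cvg_half_expn | exact: cvg_cst].
have pos : \forall k \near \oo, 0 < (1 : R) + 2^-1 ^+ k * x.
  by move/cvgr_gt: h0; apply; exact: ltr01.
apply: (@squeeze_cvgr _ _ _ R (fun k => expR (x / (1 + 2^-1 ^+ k * x)))
  (fun=> expR x)).
- apply: filterS pos => k hk; apply/andP; split.
    rewrite -[leLHS](_ : expR ((2 ^ k)%:R *
      (2^-1 ^+ k * x / (1 + 2^-1 ^+ k * x))) = _); last first.
      by rewrite !mulrA half_expn_mul mul1r.
    rewrite expRM_natl lerXn2r ?nnegrE ?expR_ge0 ?(ltW hk) //.
    have := expR_ge1Dx (- (2^-1 ^+ k * x / (1 + 2^-1 ^+ k * x))).
    rewrite expRN -[leLHS](_ : (1 + 2^-1 ^+ k * x)^-1 = _); last first.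
      by field; rewrite gt_eqF.
    by rewrite lef_pV2 ?posrE ?expR_gt0.
  rewrite -[leRHS](_ : expR ((2 ^ k)%:R * (2^-1 ^+ k * x)) = _); last first.
    by rewrite mulrA half_expn_mul mul1r.
  by rewrite expRM_natl lerXn2r ?nnegrE ?expR_ge0 ?(ltW hk) // expR_ge1Dx.
- apply: continuous_cvg; first exact: continuous_expR.
  rewrite -[X in _ --> X]divr1; apply: cvgM; first exact: cvg_cst.
  by apply: cvgV => //; rewrite oner_eq0.
- exact: cvg_cst.
Qed.

(** From [exp (- t / 4) >= 1 - t / 4] one gets [exp t <= (1 - t / 4)^-4], and the claim becomes
    polynomial. *)
Lemma expR_le_quadratic (t : R) : 0 <= t -> t <= 1 / 2 -> expR t <= 1 + t + t ^+ 2.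
Proof.
move=> t0 t1; have := expR_ge1Dx (- (t / 4)).
have q0 : 0 < 1 - t / 4 by lra.
have -> : expR t = expR (t / 4) ^+ 4.
  by rewrite -expRM_natr; congr expR; field.
rewrite expRN -lef_pV2 ?posrE ?invr_gt0 ?expR_gt0 // invrK => h.
have h4 : expR (t / 4) ^+ 4 <= (1 - t / 4)^-1 ^+ 4.
  by rewrite lerXn2r ?nnegrE ?expR_ge0 ?invr_ge0 ?(ltW q0).
apply: (le_trans h4); rewrite exprVn -[leLHS]div1r ler_pdivrMr ?exprn_gt0 //.
rewrite -subr_ge0.
have -> : (1 + t + t ^+ 2) * (1 - t / 4) ^+ 4 - 1 =
  t ^+ 2 * (96 - 176 * t + 81 * t ^+ 2 - 15 * t ^+ 3 + t ^+ 4) / 256 by field.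
rewrite divr_ge0 // mulr_ge0 ?sqr_ge0 //.
(* For [t <= 1 / 2] the two negative terms amount to at most 88 + 8, which the constant 96
   absorbs. *)
have t3 : 15 * t ^+ 3 <= 8 by nra.
have : 0 <= t ^+ 4 by rewrite exprn_ge0.
nra.
Qed.

End ExpLimits.

Section GoldenThompsonInequality.
Variables (R : realType) (n : nat).
Implicit Types A B : 'M[R]_n.

Lemma cvg_compound_mx A i j : A^T = A ->
  ((1 + 2^-1 ^+ k *: A) ^+ (2 ^ k) : 'M[R]_n) i j @[k --> \oo] --> expmx A i j.
Proof.
move=> /symmetric_spectral[P [d [PP ->]]]; rewrite -/(spec_mx P d) expmx_spec //.
have -> : (fun k => ((1 + 2^-1 ^+ k *: spec_mx P d) ^+ (2 ^ k) : 'M[R]_n) i j) =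
  fun k => \sum_l P l i * (1 + 2^-1 ^+ k * d 0 l) ^+ (2 ^ k) * P l j.
  apply/funext => k; rewrite -[1](spec_mx_cst PP 1) spec_mxZ spec_mxD.
  rewrite spec_mxX // spec_mxE; apply: eq_bigr => l _; by rewrite !mxE.
rewrite spec_mxE; apply: cvg_sum_seq => l; rewrite mxE.
apply: cvgM; last exact: cvg_cst.
by apply: cvgM; [exact: cvg_cst | exact: cvg_compound].
Qed.

Lemma cvg_mxtrace_mul (U V : nat -> 'M[R]_n) (L M : 'M[R]_n) :
  (forall i j, U k i j @[k --> \oo] --> L i j) ->
  (forall i j, V k i j @[k --> \oo] --> M i j) ->
  \tr (U k * V k) @[k --> \oo] --> \tr (L * M).
Proof.
move=> UL VM; rewrite /mxtrace; apply: cvg_sum_seq => i.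
rewrite [X in _ --> X]mxE; under eq_fun do rewrite mxE.
by apply: cvg_sum_seq => j; apply: cvgM.
Qed.

(** Lie product formula along [m = 2^k], [h = 1 / m]: since [(1 + h A)(1 + h B)] differs from
    [1 + h (A + B)] by [h^2 A B] only, its [m]-th power tends to [exp (A + B)]. The trace inequality
    for powers of two then passes to the limit. *)
Theorem golden_thompson A B : A^T = A -> B^T = B ->
  \tr (expmx (A + B)) <= \tr (expmx A *m expmx B).
Proof.
move=> sA sB; pose h k : R := 2^-1 ^+ k; pose m k := (2 ^ k)%N.
pose X k := 1 + h k *: A; pose Y k := 1 + h k *: B; pose Z k := 1 + h k *: (A + B).
have [a a0 bA] := row_bound_exists A; have [b b0 bB] := row_bound_exists B.
have h0 k : 0 <= h k by rewrite exprn_ge0 // invr_ge0.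
have sX k : (X k)^T = X k by rewrite linearD /= linearZ /= trmx1 sA.
have sY k : (Y k)^T = Y k by rewrite linearD /= linearZ /= trmx1 sB.
have sAB : (A + B)^T = A + B by rewrite linearD /= sA sB.
(* The telescoping bound reads [m (h^2 a b) q^m], where [m h = 1] and [q^m = exp (a + b)]. *)
have bound k i j :
  `|((X k * Y k) ^+ m k - Z k ^+ m k) i j| <= a * b * expR (a + b) * h k.
  pose q := expR (h k * (a + b)).
  have bnd1 (C : 'M[R]_n) c : row_bound C c -> row_bound (1 + h k *: C) (1 + h k * c).
    move=> hC; apply: row_boundD; first exact: row_bound1.
    by rewrite -[X in X * c](ger0_norm (h0 k)); exact: row_boundZ.
  have bX : row_bound (X k) (expR (h k * a)).
    by apply: row_bound_le (bnd1 _ _ bA) _; exact: expR_ge1Dx.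
  have bY : row_bound (Y k) (expR (h k * b)).
    by apply: row_bound_le (bnd1 _ _ bB) _; exact: expR_ge1Dx.
  have bXY : row_bound (X k * Y k) q.
    by rewrite /q [h k * _]mulrDr expRD; apply: row_boundM => //; exact: expR_ge0.
  have bZ : row_bound (Z k) q.
    by apply: row_bound_le (bnd1 _ _ (row_boundD bA bB)) _; exact: expR_ge1Dx.
  have bd : row_bound (X k * Y k - Z k) (h k ^+ 2 * (a * b)).
    have -> : X k * Y k - Z k = h k ^+ 2 *: (A * B).
      rewrite /X /Y /Z mulrDl mul1r mulrDr mulr1 scalerDr.
      rewrite -[(h k *: A) * _]/(_ *m _) -scalemxAl -scalemxAr scalerA -expr2.
      rewrite -[A *m B]/(A * B); move: (A * B) => C.
      by apply/matrixP => u v; rewrite !mxE; ring.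
    have := row_boundZ (h k ^+ 2) (row_boundM bA bB (ltW b0)).
    by rewrite ger0_norm ?sqr_ge0.
  have q1 : 1 <= q.
    by rewrite /q -expR0 ler_expR mulr_ge0 // addr_ge0 // ltW.
  have e0 : 0 <= h k ^+ 2 * (a * b) by rewrite mulr_ge0 ?sqr_ge0 // mulr_ge0 // ltW.
  have := row_bound_entry i j (row_bound_subX (m k) bXY bZ bd q1 e0).
  have -> : q ^+ m k = expR (a + b).
    by rewrite /q -expRM_natl mulrA half_expn_mul mul1r.
  move=> /le_trans; apply.
  have -> : (m k)%:R * (h k ^+ 2 * (a * b)) = (a * b) * h k.
    have hm : (m k)%:R * h k = 1 by exact: half_expn_mul.
    rewrite -[RHS]mulr1 -[X in _ = _ * X]hm; move: (m k)%:R (h k) => M H; ring.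
  by rewrite mulrAC.
have cXY i j : ((X k * Y k) ^+ m k : 'M[R]_n) i j @[k --> \oo] --> expmx (A + B) i j.
  have -> : (fun k => ((X k * Y k) ^+ m k : 'M[R]_n) i j) =
     fun k => ((X k * Y k) ^+ m k - Z k ^+ m k) i j + (Z k ^+ m k) i j.
    by apply/funext => k; rewrite !mxE subrK.
  rewrite -[X in _ --> X]add0r; apply: cvgD; last exact: cvg_compound_mx.
  have c0 : a * b * expR (a + b) * h k @[k --> \oo] --> (0 : R).
    rewrite -[X in _ --> X](mulr0 (a * b * expR (a + b))).
    by apply: cvgM; [exact: cvg_cst | exact: cvg_half_expn].
  apply: (@squeeze_cvgr _ _ _ R (fun k => - (a * b * expR (a + b) * h k))
     (fun k => a * b * expR (a + b) * h k)) => //.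
    by apply: nearW => k; rewrite -ler_norml.
  by rewrite -oppr0; exact: cvgN.
have cL : \tr ((X k * Y k) ^+ m k * 1) @[k --> \oo] --> \tr (expmx (A + B) * 1).
  by apply: cvg_mxtrace_mul => // i j; exact: cvg_cst.
have cR : \tr (X k ^+ m k * Y k ^+ m k) @[k --> \oo] --> \tr (expmx A * expmx B).
  by apply: cvg_mxtrace_mul => i j; exact: cvg_compound_mx.
rewrite -[expmx (A + B)]mulr1; apply: ler_cvg_to cL cR _.
by apply: nearW => k; rewrite mulr1; exact: (mxtrace_expr_mul_le _ _ k).2.
Qed.

End GoldenThompsonInequality.

(** * Hamiltonian updates *)

Section PsdTraces.
Variables (R : realType) (n : nat).
Implicit Types A M W X : 'M[R]_n.

Lemma symmetricmxP A : reflect (A^T = A) (A \is symmetricmx).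
Proof.
rewrite is_hermitianmxE expr0 scale1r map_mx_id //; rewrite eq_sym; exact: eqP.
Qed.

Lemma mxtrace_mul_psd_ge0 A W : A^T = A -> (forall u, 0 <= qform A u) ->
  (forall u, 0 <= qform W u) -> 0 <= \tr (W *m A).
Proof.
move=> sA pA pW; have [P [d [PP AE]]] := symmetric_spectral sA.
rewrite AE -/(spec_mx P d) mxtrace_mul_spec; apply: sumr_ge0 => i _.
by rewrite mulr_ge0 // -(qform_spec_row PP) /spec_mx -AE.
Qed.

Lemma expmx_psd A : A^T = A ->
  [/\ (expmx A)^T = expmx A, forall u, 0 <= qform (expmx A) u &
      (0 < n)%N -> 0 < \tr (expmx A)].
Proof.
move=> /symmetric_spectral[P [d [PP ->]]]; rewrite -/(spec_mx P d) expmx_spec //.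
split=> [|u|n0]; first exact: tr_spec_mx.
  by apply: qform_spec_ge0 => i; rewrite mxE expR_ge0.
rewrite mxtrace_spec // (bigD1 (Ordinal n0)) //= mxE ltr_pwDl ?expR_gt0 //.
by apply: sumr_ge0 => i _; rewrite mxE expR_ge0.
Qed.

Lemma expmx0 : expmx (0 : 'M[R]_n) = 1%:M.
Proof.
have PP : (1%:M : 'M[R]_n) *m 1%:M^T = 1%:M by rewrite trmx1 mulmx1.
rewrite -(spec_mx_cst PP 1) -[in LHS](scale0r 1%:M) scalemx1.
rewrite -(spec_mx_cst PP 0) expmx_spec //; congr spec_mx.
by apply/rowP => i; rewrite !mxE expR0.
Qed.

(** [tr (X A)] is an average of the eigenvalues of [A], hence at most the largest one, whose
    exponential is one of the positive terms of [tr (exp A)]. *)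
Lemma expR_mxtrace_le A X : A^T = A -> (forall u, 0 <= qform X u) -> \tr X = 1 ->
  expR (\tr (X *m A)) <= \tr (expmx A).
Proof.
move=> /symmetric_spectral[P [d [PP ->]]] pX tX.
rewrite -/(spec_mx P d) expmx_spec // mxtrace_mul_spec mxtrace_spec //.
have n0 : (0 < n)%N.
  rewrite lt0n; apply/negP => /eqP n0; move: tX; rewrite /mxtrace big1.
    by move/esym/eqP; rewrite oner_eq0.
  by move=> i; have := ltn_ord i; rewrite {2}n0.
have [i _ imax] := @arg_maxP _ _ _ (Ordinal n0) predT (fun i => d 0 i) isT.
apply: (@le_trans _ _ (expR (d 0 i))).
  rewrite ler_expR -[leRHS]mulr1 -tX -(sum_qform_row PP) mulr_sumr.
  by apply: ler_sum => j _; rewrite ler_wpM2r //; exact: imax.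
rewrite (bigD1 i) //= mxE lerDl; apply: sumr_ge0 => j _.
by rewrite mxE expR_ge0.
Qed.

(** The eigenvalues [x] of [M] lie in [0, 1], where [exp (delta x) <= 1 + delta x + (delta x)^2 <= 1
    + (delta + delta^2) x]. *)
Lemma mxtrace_mul_expmx_le M W (delta : R) : M^T = M ->
  (forall u, 0 <= qform M u) -> (forall u, qform M u <= qform 1%:M u) ->
  (forall u, 0 <= qform W u) -> 0 <= delta -> delta <= 1 / 2 ->
  \tr (W *m expmx (delta *: M)) <= \tr W + (delta + delta ^+ 2) * \tr (W *m M).
Proof.
move=> sM pM lM pW d0 d1; have [P [d [PP ME]]] := symmetric_spectral sM.
have dge i : 0 <= d 0 i by rewrite -(qform_spec_row PP) /spec_mx -ME.
have dle i : d 0 i <= 1.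
  by rewrite -(qform_spec_row PP) /spec_mx -ME -(qform1_row PP i).
rewrite ME -/(spec_mx P d) spec_mxZ expmx_spec // !mxtrace_mul_spec.
rewrite -(sum_qform_row PP) mulr_sumr -big_split /=; apply: ler_sum => i _.
rewrite mulrA -[X in _ <= X + _]mul1r -mulrDl ler_wpM2r // !mxE.
have h : expR (delta * d 0 i) <= 1 + delta * d 0 i + (delta * d 0 i) ^+ 2.
  apply: expR_le_quadratic; first exact: mulr_ge0.
  by apply: le_trans d1; rewrite ler_piMr.
apply: (le_trans h); rewrite -addrA lerD2l mulrDl lerD2l exprMn.
rewrite ler_wpM2l ?sqr_ge0 // expr2 ler_piMl //.
Qed.

End PsdTraces.

Lemma nceil_ge (R : realType) (x : R) : x <= (nceil x)%:R.
Proof.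
have := ceil_ge x; rewrite /nceil; case: (Num.ceil x) => m // /le_trans; apply.
by rewrite mulr0n lerz0.
Qed.

(** * Regret analysis of the updates for symmetric contractions *)

Section HamiltonianUpdatesCorrectness.
Variables (R : realType) (N : nat) (eps : R).
Variables (I : finType) (A' : I -> 'M[R]_N) (b' : I -> R).
Hypothesis N_gt1 : (1 < N)%N.
Hypothesis eps_gt0 : 0 < eps.
Hypothesis A'_sym : forall j, (A' j)^T = A' j.
Hypothesis A'_contr : forall j u, `|qform (A' j) u| <= qform 1%:M u.

Let gain j : 'M[R]_N := 2^-1 *: (1%:M - A' j).

Let gain_sym j : (gain j)^T = gain j.
Proof. by rewrite /gain linearZ /= linearB /= trmx1 A'_sym. Qed.

Let gain_ge0 j u : 0 <= qform (gain j) u.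
Proof.
rewrite qformZ qformB mulr_ge0 ?invr_ge0 // subr_ge0.
exact: le_trans (ler_norm _) (A'_contr j u).
Qed.

Let gain_le1 j u : qform (gain j) u <= qform 1%:M u.
Proof.
rewrite qformZ qformB; have := A'_contr j u; rewrite ler_norml => /andP[h _].
have := qform1_ge0 u; lra.
Qed.

Let mxtrace_gain W j : \tr (W *m gain j) = 2^-1 * (\tr W - \tr (A' j *m W)).
Proof.
rewrite /gain -scalemxAr mxtraceZ mulmxBr mulmx1 [\tr (A' j *m W)]mxtrace_mulC.
by rewrite -[in RHS]raddfB.
Qed.

Let mxtrace_gain_itv W j : (forall u, 0 <= qform W u) ->
  0 <= \tr (W *m gain j) <= \tr W.
Proof.
move=> pW; apply/andP; split; first exact: mxtrace_mul_psd_ge0.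
rewrite -subr_ge0; have -> : \tr W - \tr (W *m gain j) = \tr (W *m (1%:M - gain j)).
  by rewrite mulmxBr mulmx1 raddfB.
apply: mxtrace_mul_psd_ge0 => // [|u].
  by rewrite linearB /= trmx1 gain_sym.
by rewrite qformB subr_ge0.
Qed.

Section Regret.
Variable X : 'M[R]_N.
Hypothesis X_ge0 : forall u, 0 <= qform X u.
Hypothesis X_tr : \tr X = 1.
Hypothesis X_feasible : forall j, \tr (A' j *m X) <= b' j.

Let delta := eps / 4.

(** Compared with the feasible [X], a violation exceeds [eps], and the factor 1/2 in the gain halves
    it. Both gains lie in [0, 1], whence [eps < 2]; this is what gives [delta <= 1 / 2] at each
    update. *)
Lemma violated_gain P j : (forall u, 0 <= qform P u) -> \tr P = 1 ->
  b' j + eps < \tr (A' j *m P) ->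
  eps < 2 /\ \tr (P *m gain j) + eps / 2 < \tr (X *m gain j).
Proof.
move=> pP tP; have := mxtrace_gain_itv j pP; have := mxtrace_gain_itv j X_ge0.
rewrite !mxtrace_gain X_tr tP => /andP[_ hX] /andP[hP _].
have := X_feasible j; split; lra.
Qed.

Lemma expmx_gain_step S W j : S^T = S -> W = expmx (delta *: S) -> delta <= 1 / 2 ->
  \tr (expmx (delta *: (S + gain j))) <=
  \tr W * expR ((delta + delta ^+ 2) * \tr ((\tr W)^-1 *: W *m gain j)).
Proof.
move=> sS WE d1; have d0 : 0 <= delta by rewrite divr_ge0 // ltW.
have sdS : (delta *: S)^T = delta *: S by rewrite linearZ /= sS.
have sdG : (delta *: gain j)^T = delta *: gain j by rewrite linearZ /= gain_sym.
have [_ pW /(_ (ltnW N_gt1)) tW] := expmx_psd sdS.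
rewrite -WE in pW tW.
rewrite scalerDr; apply: (le_trans (golden_thompson sdS sdG)); rewrite -WE.
have step := mxtrace_mul_expmx_le (gain_sym j) (gain_ge0 j) (gain_le1 j) pW d0 d1.
apply: (le_trans step).
rewrite -scalemxAl mxtraceZ.
set c := delta + _; set g := \tr (W *m _).
have -> : \tr W + c * g = \tr W * (1 + c * ((\tr W)^-1 * g)).
  by field; rewrite gt_eqF.
by rewrite ler_pM2l // expR_ge1Dx.
Qed.

(** Invariant after [t] updates, where [p] accumulates the gains of the iterates [P]: [X] has gained
    at least [t eps / 2] more than [p], strictly once [t > 0], while [tr W] is controlled by [p].
    The total [m + t] stays constant along the run. *)
Lemma HU_loop_gain m S W eta : HU_loop eps A' b' m S W eta -> eta = false ->
  forall t p, S^T = S -> W = expmx (delta *: S) ->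
  p + t%:R * (eps / 2) <= \tr (X *m S) ->
  ((0 < t)%N -> p + t%:R * (eps / 2) < \tr (X *m S)) -> p <= t%:R ->
  \tr W <= N%:R * expR ((delta + delta ^+ 2) * p) -> (0 < m + t)%N ->
  (m + t)%:R < 16 * ln (N%:R : R) / eps ^+ 2.
Proof.
elim=> // {m S W eta}.
  move=> S W _ t p sS -> _ hp pt tW; rewrite !add0n => /hp {}hp.
  have sdS : (delta *: S)^T = delta *: S by rewrite linearZ /= sS.
  have := le_trans (expR_mxtrace_le sdS X_ge0 X_tr) tW.
  have N0 : 0 < N%:R :> R by rewrite ltr0n ltnW.
  rewrite -[X in X * expR _](lnK N0) -expRD ler_expR -scalemxAr mxtraceZ => h.
  rewrite ltr_pdivlMr ?exprn_gt0 //.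
  move: h hp pt; rewrite /delta; move: (t%:R) (ln _) (\tr _) => T L g h hp pt.
  (* With [d = eps / 4], the chain [d (p + T eps / 2) < d g <= L + (d + d^2) p] and [p <= T] leave
     [T eps^2 / 8 < L + T eps^2 / 16]. *)
  have h1 : eps / 4 * (p + T * (eps / 2)) < eps / 4 * g by rewrite ltr_pM2l // divr_gt0.
  have h2 : (eps / 4) ^+ 2 * p <= (eps / 4) ^+ 2 * T by rewrite ler_wpM2l // sqr_ge0.
  lra.
move=> m S W j eta P S' hj _ IH eta0 t p sS WE hp _ pt tW _.
have sdS : (delta *: S)^T = delta *: S by rewrite linearZ /= sS.
have [sW pW /(_ (ltnW N_gt1)) tW0] := expmx_psd sdS; rewrite -WE in sW pW tW0.
have pP u : 0 <= qform P u by rewrite /P qformZ mulr_ge0 // invr_ge0 ltW.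
have tP : \tr P = 1 by rewrite /P mxtraceZ mulVf // gt_eqF.
have [eps2 hg] := violated_gain pP tP hj.
rewrite addSnnS; apply: (IH eta0 t.+1 (p + \tr (P *m gain j))) => //.
- by rewrite /S' linearD /= sS gain_sym.
- by rewrite /S' mulmxDr raddfD /= -natr1 mulrDl mul1r -/(gain j); lra.
- by move=> _; rewrite /S' mulmxDr raddfD /= -natr1 mulrDl mul1r -/(gain j); lra.
- by have /andP[_] := mxtrace_gain_itv j pP; rewrite tP -natr1; lra.
2: by rewrite addnS.
have d1 : delta <= 1 / 2 by rewrite /delta; lra.
have := expmx_gain_step j sS WE d1; rewrite -/P -/S' => /le_trans; apply.
by rewrite mulrDr expRD mulrA ler_wpM2r // expR_ge0.
Qed.

Lemma HU_feasible_true : ~ HU eps A' b' false.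
Proof.
rewrite /HU; set T := nceil _.
have N1 : 1 < N%:R :> R by rewrite ltr1n.
have x0 : 0 < 16 * ln (N%:R : R) / eps ^+ 2.
  by rewrite divr_gt0 ?exprn_gt0 // mulr_gt0 // ln_gt0.
have Tge : 16 * ln (N%:R : R) / eps ^+ 2 <= T%:R.
  exact: nceil_ge.
(* With zero iterations the loop would answer [false] without testing anything; [N > 1] makes [ln N]
   positive and excludes this. *)
have T0 : (0 < T)%N by rewrite -(ltr0n R); exact: lt_le_trans Tge.
move=> loop; move: Tge; rewrite leNgt => /negP; apply; rewrite -(addn0 T).
apply: (HU_loop_gain loop erefl (p := 0)); rewrite ?addn0 //.
- by rewrite trmx0.
- by rewrite scaler0 expmx0.
- by rewrite mul0r addr0 mulmx0 raddf0.
- by rewrite mulr0 expR0 mulr1 mxtrace1.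
Qed.

End Regret.

(** Each [W] in the run is the exponential of a symmetric matrix, so the normalised iterate at which
    the loop stops is positive semidefinite of trace 1. *)
Lemma HU_true_feasible : HU eps A' b' true ->
  exists P : 'M[R]_N, [/\ P^T = P, forall u, 0 <= qform P u, \tr P = 1 &
    forall j, \tr (A' j *m P) <= b' j + eps].
Proof.
rewrite /HU; move: (nceil _) => m.
have : exists2 S : 'M[R]_N, S^T = S & 1%:M = expmx S.
  by exists 0; rewrite ?trmx0 // expmx0.
have : (0 : 'M[R]_N)^T = 0 by rewrite trmx0.
move: 0 1%:M => S W sS hW; move: {-2}true (erefl true) => eta eta_true loop.
elim: loop sS hW eta_true => // {m S W eta}.
  move=> m S W P hP sS [S' sS' WS'] _; exists P.
  have [sW pW tW] := expmx_psd sS'; rewrite -WS' in sW pW tW.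
  have {}tW := tW (ltnW N_gt1).
  split=> [|u||j].
  - by rewrite /P linearZ /= sW.
  - by rewrite /P qformZ mulr_ge0 // invr_ge0 ltW.
  - by rewrite /P linearZ /= mulVf // gt_eqF.
  - by rewrite leNgt; apply/negP; exact: hP.
move=> m S W j eta P S' hj _ IH sS _; apply: IH.
  by rewrite /S' linearD /= sS gain_sym.
exists ((eps / 4) *: S') => //.
by rewrite /S' linearZ /= linearD /= sS gain_sym.
Qed.

End HamiltonianUpdatesCorrectness.

(** * Moment and Gram matrices *)

Section Polynomials.
Variables (R : realType) (n : nat).
Implicit Types (f : {mpoly R[n]}) (x : n.-tuple R).

Definition mon_val x (m : mpoly.multinom n) : R := \prod_(i < n) tnth x i ^+ m i.

Lemma pval_mpolyX x m : pval (mpoly.mpolyX R m) x = mon_val x m.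
Proof. by rewrite /pval mevalX. Qed.

Lemma mon_valD x m m' : mon_val x (mnm_add m m') = mon_val x m * mon_val x m'.
Proof.
by rewrite /mon_val -big_split; apply: eq_bigr => i _; rewrite mnmDE exprD.
Qed.

Lemma mon_val0 x : mon_val x mnm0 = 1.
Proof. by rewrite /mon_val big1 // => i _; rewrite mnm0E expr0. Qed.

Lemma pval_sum x f t : deg_le f t ->
  pval f x = \sum_(g : midx n t) f@_g * mon_val x g.
Proof.
move=> df; rewrite /pval {1}(mpolywE df) raddf_sum; apply: eq_bigr => g _.
by rewrite /= mevalZ mevalX.
Qed.

Lemma mon_valU x i : mon_val x (mnm1 i) = tnth x i.
Proof.
rewrite /mon_val (bigD1 i) //= mnm1E eqxx expr1 big1 ?mulr1 // => j /negPf ji.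
by rewrite mnm1E eq_sym ji expr0.
Qed.

Lemma ler_sum_cond (I : finType) (P : pred I) (F : I -> R) i :
  P i -> (forall j, 0 <= F j) -> F i <= \sum_(j | P j) F j.
Proof. by move=> Pi F0; rewrite (bigD1 i) //= lerDl sumr_ge0. Qed.

(** Every nonzero multi-index of degree at most [b] is a unit index plus one of degree less than
    [b], so the nonzero part of the sum is at most [r] times the previous sum, and
    [1 + r / (1 - r) = 1 / (1 - r)]. *)
Lemma sum_mon_val_le x (r : R) b : \sum_(i < n) `|tnth x i| <= r -> r < 1 ->
  \sum_(g : bmultinom n b) `|mon_val x g| <= (1 - r)^-1.
Proof.
move=> xr r1; have r1' : 0 < 1 - r by rewrite subr_gt0.
elim: b => [|b IHb].
  by rewrite big1 ?invr_ge0 ?ltW // => g _; have := bmdeg g.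
have shiftP (i : 'I_n) (h : bmultinom n b) : (mdeg (mnm_add (mnm1 i) h) < b.+1)%N.
  by rewrite mdegD mdeg1 add1n ltnS bmdeg.
pose shift i h := BMultinom (shiftP i h).
have low : \sum_(g : bmultinom n b.+1 | g != bm0) `|mon_val x g| <=
   \sum_(i < n) `|tnth x i| * \sum_(h : bmultinom n b) `|mon_val x h|.
  (* Indicators turn the product into a sum over all [g]; each nonzero [g] is reached at least once,
     and repetitions only increase the bound. *)
  have -> : \sum_(i < n) `|tnth x i| * \sum_(h : bmultinom n b) `|mon_val x h| =
      \sum_(i < n) \sum_(h : bmultinom n b) \sum_(g : bmultinom n b.+1)
        (g == shift i h)%:R * `|mon_val x g|.
    apply: eq_bigr => i _; rewrite mulr_sumr; apply: eq_bigr => h _.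
    rewrite (bigD1 (shift i h)) //= eqxx mul1r big1 => [|g /negPf ->].
      by rewrite addr0 mon_valD mon_valU normrM.
    exact: mul0r.
  under [leRHS]eq_bigr do rewrite exchange_big /=.
  rewrite exchange_big /= big_mkcond /=; apply: ler_sum => g _.
  case: ifPn => [g0|_]; last first.
    by apply: sumr_ge0 => i _; apply: sumr_ge0 => h _; rewrite mulr_ge0.
  have [i gi] : exists i, g i != 0%N.
    apply/existsP; apply: contraR g0; rewrite negb_exists => /forallP g0.
    apply/eqP/val_inj/mnmP => i /=; rewrite mnm0E; apply/eqP.
    by have := g0 i; rewrite negbK.
  have gE : mnm_add (mnm_sub g (mnm1 i)) (mnm1 i) = g by apply: submK; rewrite lep1mP.
  have hP : (mdeg (mnm_sub g (mnm1 i)) < b)%N.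
    by have := bmdeg g; rewrite -{1}gE mdegD mdeg1 addn1 ltnS.
  pose h := BMultinom hP.
  apply: (@le_trans _ _ (\sum_h' (g == shift i h')%:R * `|mon_val x g|)).
    rewrite -[leLHS]mul1r -[X in X * _ <= _](_ : (g == shift i h)%:R = 1).
      by apply: (@ler_sum_cond _ predT _ h) => // h'; rewrite mulr_ge0.
    suff -> : g == shift i h by [].
    by apply/eqP/val_inj; rewrite /= addmC gE.
  apply: (@ler_sum_cond _ predT (fun i => \sum_h' _) i) => // i'.
  by apply: sumr_ge0 => h' _; rewrite mulr_ge0.
rewrite (bigD1 bm0) //= mon_val0 normr1.
apply: (@le_trans _ _ (1 + r / (1 - r))); last first.
  by rewrite le_eqVlt; apply/orP; left; apply/eqP; field; rewrite gt_eqF.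
rewrite lerD2l (le_trans low) // -mulr_suml ler_pM ?sumr_ge0 //.
Qed.

Section Moments.
Variable k : nat.
Implicit Types (y : midx n (2 * k) -> R) (G : 'M[R]_#|{: midx n k}|).

Lemma tr_Bmx (g : midx n (2 * k)) : (Bmx R g)^T = Bmx R g.
Proof.
apply/matrixP => i j; rewrite !mxE; congr ((_ == _)%:R); apply/val_inj.
by rewrite /= addmC.
Qed.

(** A row has at most one nonzero entry, because [alpha + beta = g] determines [beta]. *)
Lemma row_bound_Bmx (g : midx n (2 * k)) : row_bound (Bmx R g) 1.
Proof.
move=> i; have [[j0 Hj]|nj] := pselect (exists j0, Bmx R g i j0 != 0).
  rewrite (bigD1 j0) //= big1 ?addr0 => [|j jj0].
    by rewrite mxE; case: eqP; rewrite ?normr1 ?normr0.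
  move: Hj; rewrite !mxE; case: (midx_add _ (enum_val j0) =P g) => [gE _|_].
    2: by rewrite eqxx.
  case: eqP => [gE'|_]; last by rewrite normr0.
  case/negP: jj0; apply/eqP/enum_val_inj/val_inj.
  have := congr1 val gE; rewrite -[in RHS]gE' /=.
  move=> /(congr1 (fun m => mnm_sub m (enum_val i))).
  by rewrite ![mnm_add (enum_val i) _]addmC !addmK.
rewrite big1 // => j _; apply/eqP; rewrite normr_eq0.
by apply/negP => /negP Hj; apply: nj; exists j.
Qed.

Lemma moment_mx_sum y : moment_mx y = \sum_g y g *: Bmx R g.
Proof.
apply/matrixP => i j; rewrite mxE summxE.
rewrite (bigD1 (midx_add (enum_val i) (enum_val j))) //= !mxE eqxx mulr1.
rewrite big1 ?addr0 // => g /negPf; rewrite !mxE eq_sym => ->; exact: mulr0.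
Qed.

Lemma mxtrace_moment_mx y G :
  \tr (moment_mx y *m G) = \sum_g \tr (Bmx R g *m G) * y g.
Proof.
rewrite moment_mx_sum mulmx_suml raddf_sum; apply: eq_bigr => g _.
by rewrite /= -scalemxAl mxtraceZ mulrC.
Qed.

Lemma tr_moment_mx y : (moment_mx y)^T = moment_mx y.
Proof.
rewrite moment_mx_sum raddf_sum; apply: eq_bigr => g _.
by rewrite /= linearZ /= tr_Bmx.
Qed.

(** The sum is the trace of [G] against the moment matrix of the Dirac measure at [x], which is the
    rank-one matrix [v_k(x) v_k(x)^T]. *)
Lemma moment_mx_dirac_ge0 x G : (forall u, 0 <= qform G u) ->
  0 <= \sum_(g : midx n (2 * k)) \tr (Bmx R g *m G) * mon_val x g.
Proof.
move=> pG; rewrite -(mxtrace_moment_mx (fun g => mon_val x g)) mxtrace_mulC.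
apply: mxtrace_mul_psd_ge0 => //; first exact: tr_moment_mx.
move=> u; rewrite qformE; set s := \sum_i _.
have -> : s = (\sum_i u i 0 * mon_val x (enum_val i : midx n k)) ^+ 2.
  rewrite expr2 mulr_suml; apply: eq_bigr => i _; rewrite mulr_sumr.
  by apply: eq_bigr => j _; rewrite mxE /= mon_valD; ring.
exact: sqr_ge0.
Qed.

(** Comparison of the coefficients of [x^g] in the sum-of-squares identity. *)
Lemma sos_coef f (l : R) G :
  f - @mpolyC n R l =
    ((monomials R n k)^T *m map_mx (@mpolyC n R) G *m monomials R n k) 0 0 ->
  forall g : midx n (2 * k), \tr (Bmx R g *m G) = f@_g - l * (g == bm0)%:R.
Proof.
move=> fG g; have := congr1 (mcoeff g) fG; rewrite mcoeffB mcoeffC => ->.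
rewrite mxE raddf_sum /= /mxtrace; apply: eq_bigr => j _.
rewrite [LHS]mxE [X in X * _]mxE mulr_suml raddf_sum; apply: eq_bigr => i _ /=.
rewrite !mxE mulrAC -mpolyXD [in RHS]mulrC mul_mpolyC mcoeffZ mcoeffX [RHS]mulrC addmC.
by rewrite bmeqP.
Qed.

End Moments.
End Polynomials.

(** * Moments of a measure and trace bound *)

Lemma lambda_min_le (R : realType) (N : nat) (M : 'M[R]_N) : M^T = M ->
  forall u, 0 <= qform (M - (lambda_min M)%:M) u.
Proof.
move=> sM; have [P [d [PP ME]]] := symmetric_spectral sM.
(* An infimum lies below the elements of a set only if that set is bounded below. *)
have lb : has_lbound [set l | eigenvalue M l].
  have [c c0 bc] := row_bound_exists M; exists (- c) => l /= /eigenvalueP[v vM v0].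
  have v1 : 0 < qform 1%:M v^T by rewrite qform1_gt0 // trmx_eq0.
  have := qform_row_bound v^T sM bc.
  rewrite ler_norml => /andP[+ _]; rewrite {2}/qform trmxK vM -scalemxAl mxE.
  have -> : (v *m v^T) 0 0 = qform 1%:M v^T by rewrite /qform trmxK mulmx1.
  by rewrite -mulNr ler_pM2r.
have dge i : lambda_min M <= d 0 i.
  apply: ge_inf => //=; apply/eigenvalueP; exists (row i P).
    by rewrite {1}ME -/(spec_mx P d) eigen_spec_row.
  apply/eqP => P0; have := qform1_row PP i; rewrite P0 /qform trmx0 mulmx0 mxE.
  by move/esym/eqP; rewrite oner_eq0.
rewrite {1}ME -/(spec_mx P d) => u.
have -> : spec_mx P d - (lambda_min M)%:M = spec_mx P (d - const_mx (lambda_min M)).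
  by rewrite -(spec_mx_cst PP) -spec_mxD -scaleN1r spec_mxZ scaleN1r.
by apply: qform_spec_ge0 => i; rewrite !mxE subr_ge0.
Qed.

Section MeasureBound.
Variables (R : realType) (n k : nat) (mu : {measure set (n.-tuple R) -> \bar R}).
Hypothesis mu_moments : has_moments mu (2 * k)%N.
Implicit Types (f : {mpoly R[n]}).

Lemma Rintegral_lincomb (I : Type) (s : seq I) (c : I -> R) (F : I -> n.-tuple R -> R) :
  (forall i, mu.-integrable setT (fun x => (F i x)%:E)) ->
  mu.-integrable setT (fun x => (\sum_(i <- s) c i * F i x)%:E) /\
  \int[mu]_x (\sum_(i <- s) c i * F i x) = \sum_(i <- s) c i * \int[mu]_x F i x.
Proof.
move=> intF; elim: s => [|i s [IHi IHe]].
  split.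
    by under eq_fun do rewrite big_nil; exact: integrable0.
  under eq_Rintegral do rewrite big_nil.
  by rewrite big_nil /Rintegral integral0.
have intc : mu.-integrable setT (fun x => (c i * F i x)%:E).
  by under eq_fun do rewrite EFinM; apply: integrableZl.
split.
  under eq_fun do rewrite big_cons EFinD.
  exact: integrableD.
under eq_Rintegral do rewrite big_cons.
by rewrite RintegralD // IHe big_cons RintegralZl //; exact: intF.
Qed.

Lemma Rintegral_pval f (c : R) : deg_le f (2 * k) ->
  \int[mu]_x (pval f x - c) =
  \sum_(g : midx n (2 * k)) (f@_g - c * (g == bm0)%:R) * moment mu g.
Proof.
move=> df; rewrite -(Rintegral_lincomb _ _ mu_moments).2.
apply: eq_Rintegral => x _; rewrite (pval_sum _ df).
under [RHS]eq_bigr do rewrite pval_mpolyX mulrBl.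
rewrite sumrB; congr (_ - _); rewrite (bigD1 bm0) //= eqxx mon_val0 !mulr1.
by rewrite big1 ?addr0 // => g /negPf ->; rewrite mulr0 mul0r.
Qed.

Lemma moment0_ge0 : 0 <= moment mu (bm0 : midx n (2 * k)).
Proof.
by apply: Rintegral_ge0 => x _; rewrite pval_mpolyX mon_val0.
Qed.

Lemma sos_trace_le1 f (l lower : R) (G : 'M[R]_#|{: midx n k}|) :
  deg_le f (2 * k) -> lower <= l ->
  (forall u, 0 <= qform G u) ->
  (forall g : midx n (2 * k), \tr (Bmx R g *m G) = f@_g - l * (g == bm0)%:R) ->
  0 < lambda_min (measure_moment_mx mu k) ->
  (\int[mu]_x (pval f x - lower)) / lambda_min (measure_moment_mx mu k) <= 1 ->
  \tr G <= 1.
Proof.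
move=> df lo_l pG hG l0; rewrite ler_pdivrMr // mul1r => hint.
set M := measure_moment_mx mu k in l0 hint *.
have sM : M^T = M by exact: tr_moment_mx.
have : 0 <= \tr (G *m (M - (lambda_min M)%:M)).
  apply: mxtrace_mul_psd_ge0 => //; last exact: lambda_min_le.
  by rewrite linearB /= sM tr_scalar_mx.
rewrite mulmxBr raddfB /= mul_mx_scalar mxtraceZ subr_ge0 => h.
rewrite -(ler_pM2l l0) mulr1; apply: (le_trans h); apply: le_trans hint.
rewrite mxtrace_mulC mxtrace_moment_mx Rintegral_pval //.
(* Replacing [l] by [lower] affects only the term [g = 0], where the mass of [mu] is nonnegative. *)
apply: ler_sum => g _; rewrite hG; have [->|_] := eqVneq g bm0.
  by rewrite ler_wpM2r ?moment0_ge0 // lerD2l lerN2 ler_wpM2r.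
by rewrite !mulr0.
Qed.

End MeasureBound.

(** * Binary search with approximate answers *)

Section BinarySearchBounds.
Variables (R : realType) (N : nat) (eps : R).
Variables (J : finType) (C : 'M[R]_N) (A : J -> 'M[R]_N) (b : J -> R).
Variables (opt slack : R).
Hypothesis infeasible : forall lam,
  HU eps (BS_lhs C A) (BS_rhs b lam) false -> lam <= opt.
Hypothesis feasible : forall lam,
  HU eps (BS_lhs C A) (BS_rhs b lam) true -> opt - slack <= lam.

(** Both bounds are invariants of the search; the width halves at each step, so the final upper
    value is [out + (hi - lo) / 2^m]. *)
Lemma BS_loop_bounds m lo hi out : BS_loop eps C A b m lo hi out ->
  lo <= opt -> opt - slack <= hi ->
  out <= opt /\ opt - slack <= out + (hi - lo) / 2 ^+ m.
Proof.
elim=> {m lo hi out} [lo hi lo_opt hi_opt|m lo hi eta out lam run _ IH lo_opt hi_opt].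
  by split=> //; rewrite expr0 divr1 [lo + _]addrC subrK.
case: eta run IH => run IH.
  have [h out_opt] := IH lo_opt (feasible run); split=> //; apply: le_trans out_opt _.
  rewrite le_eqVlt; apply/orP; left; apply/eqP; congr (_ + _).
  by rewrite /lam exprS; field; rewrite expf_neq0.
have [h out_opt] := IH (infeasible run) hi_opt; split=> //; apply: le_trans out_opt _.
rewrite le_eqVlt; apply/orP; left; apply/eqP; congr (_ + _).
by rewrite /lam exprS; field; rewrite expf_neq0.
Qed.

Lemma BS_bounds lo hi out : 0 < eps -> lo < hi -> BS eps C A b lo hi out ->
  lo <= opt -> opt - slack <= hi -> out <= opt /\ opt - slack - eps <= out.
Proof.
move=> eps0 lohi run lo_opt hi_opt.
have [out_opt h] := BS_loop_bounds run lo_opt hi_opt; split=> //.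
move: h; set T := nceil _ => h.
have ln20 : 0 < ln 2 :> R by rewrite ln_gt0 // ltr1n.
have w0 : 0 < (hi - lo) / eps by rewrite divr_gt0 // subr_gt0.
(* The iteration count is at least the binary logarithm of the left side, so the final width is at
   most [eps]. *)
have : (hi - lo) / eps <= 2 ^+ T.
  rewrite -ler_ln ?posrE ?exprn_gt0 // lnXn // -[ln 2 *+ _]mulr_natl -ler_pdivrMr //.
  exact: nceil_ge.
rewrite ler_pdivrMr // mulrC -ler_pdivrMr ?exprn_gt0 // => w_le.
by rewrite lerBlDr (le_trans h) // lerD2l.
Qed.

End BinarySearchBounds.

(** * Correctness of the algorithm *)

Section UnconCorrectness.
Variables (R : realType) (n k : nat) (f : {mpoly R[n]}) (eps : R).
Hypothesis eps_gt0 : 0 < eps.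

Local Notation BN := (#|{: midx n k}| + 1)%N.
Local Notation f0 := (f@_(@mnm0 n)).

Let lhs := BS_lhs (bordered_Bmx R (bm0 : midx n (2 * k)))
  (fun g : nonzero_midx n k => bordered_Bmx R (val g)).
Let rhs := BS_rhs (fun g : nonzero_midx n k => f@_(val g)).

Lemma bordered_dim_gt1 : (1 < BN)%N.
Proof.
by rewrite addn1 ltnS; apply/card_gt0P; exists (bm0 : midx n k).
Qed.

Lemma tr_bordered_Bmx (g : midx n (2 * k)) : (bordered_Bmx R g)^T = bordered_Bmx R g.
Proof. by rewrite /bordered_Bmx tr_block_mx tr_Bmx !trmx0. Qed.

Lemma bordered_Bmx_contr (g : midx n (2 * k)) u :
  `|qform (bordered_Bmx R g) u| <= qform 1%:M u.
Proof.
rewrite -[leRHS]mul1r; apply: qform_row_bound; first exact: tr_bordered_Bmx.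
move=> i; rewrite big_split_ord /= [X in _ + X]big1 ?addr0; last first.
  move=> j _; case: (split_ordP i) => i' ->; rewrite /bordered_Bmx.
    by rewrite block_mxEur mxE normr0.
  by rewrite block_mxEdr mxE normr0.
case: (split_ordP i) => i' ->.
  by under eq_bigr do rewrite block_mxEul; exact: row_bound_Bmx.
by rewrite big1 // => j _; rewrite block_mxEdl mxE normr0.
Qed.

Lemma mxtrace_bordered_Bmx (g : midx n (2 * k)) (X : 'M[R]_BN) :
  \tr (bordered_Bmx R g *m X) = \tr (Bmx R g *m ulsubmx X).
Proof.
rewrite -{1}[X]submxK /bordered_Bmx mulmx_block mxtrace_block.
by rewrite !mul0mx !addr0 raddf0 addr0.
Qed.

Lemma BS_lhs_sym c : (lhs c)^T = lhs c.
Proof.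
case: c => [[g|g]|u] /=; rewrite ?linearN /= ?tr_bordered_Bmx //.
Qed.

Lemma BS_lhs_contr c u : `|qform (lhs c) u| <= qform 1%:M u.
Proof.
case: c => [[g|g]|v] /=; [exact: bordered_Bmx_contr | | exact: bordered_Bmx_contr].
by rewrite -scaleN1r qformZ mulN1r normrN; exact: bordered_Bmx_contr.
Qed.

Lemma HU_false_le (l lam : R) (G : 'M[R]_#|{: midx n k}|) :
  (forall u, 0 <= qform G u) -> \tr G <= 1 ->
  (forall g : midx n (2 * k), \tr (Bmx R g *m G) = f@_g - l * (g == bm0)%:R) ->
  HU eps lhs (rhs lam) false -> lam <= f0 - l.
Proof.
move=> pG tG hG; apply: contraPT => lam_gt; rewrite -ltNge in lam_gt.
(* Were [lam > f0 - l], this matrix would be feasible, with the border absorbing the missing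
   trace. *)
pose X : 'M[R]_BN := block_mx G 0 0 (1 - \tr G)%:M.
have XE (g : midx n (2 * k)) : \tr (bordered_Bmx R g *m X) = \tr (Bmx R g *m G).
  by rewrite mxtrace_bordered_Bmx block_mxKul.
apply: (@HU_feasible_true _ _ _ _ _ _ bordered_dim_gt1 eps_gt0 BS_lhs_sym
  BS_lhs_contr X).
- move=> u; rewrite /X -[u]vsubmxK /qform tr_col_mx mul_row_block !mulmx0.
  rewrite addr0 add0r mul_row_col mxE addr_ge0 //; first exact: pG.
  by rewrite -/(qform _ _) qform_scalar mulr_ge0 ?qform1_ge0 // subr_ge0.
- by rewrite /X mxtrace_block mxtrace_scalar mulr1n addrC subrK.
case=> [[g|g]|u] /=.
- by rewrite XE hG (negPf (valP g)) mulr0 subr0.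
- by rewrite mulNmx raddfN /= XE hG (negPf (valP g)) mulr0 subr0.
- by rewrite XE hG eqxx mulr1 ltW.
Qed.

Lemma HU_true_ge (x : n.-tuple R) (r lam : R) : deg_le f (2 * k) ->
  \sum_(i < n) `|tnth x i| <= r -> r < 1 ->
  HU eps lhs (rhs lam) true -> f0 - pval f x - eps * (1 + r / (1 - r)) <= lam.
Proof.
move=> df xr r1 run.
have [P [sP pP tP hP]] := HU_true_feasible bordered_dim_gt1 BS_lhs_sym run.
pose G := ulsubmx P.
have pG u : 0 <= qform G u.
  have := pP (col_mx u 0); rewrite -[P]submxK /qform tr_col_mx trmx0.
  by rewrite mul_row_block !mul0mx !addr0 mul_row_col mulmx0 addr0.
have hG0 : \tr (Bmx R (bm0 : midx n (2 * k)) *m G) <= lam + eps.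
  by have := hP (inr tt); rewrite /= mxtrace_bordered_Bmx.
have hG (g : midx n (2 * k)) : g != bm0 -> `|\tr (Bmx R g *m G) - f@_g| <= eps.
  move=> g0; pose g' : nonzero_midx n k := exist _ g g0.
  have := hP (inl (inl g')); have := hP (inl (inr g')).
  rewrite /= mulNmx raddfN /= !mxtrace_bordered_Bmx -/G ler_norml => h1 h2.
  by apply/andP; split; lra.
have split0 (F : midx n (2 * k) -> R) :
  \sum_g F g = F bm0 + \sum_(g | g != bm0) F g by rewrite (bigD1 bm0).
have := moment_mx_dirac_ge0 x pG; rewrite split0 /= mon_val0 mulr1.
set H := \sum_(g | _) _ => hH.
have := sum_mon_val_le (2 * k).+1 xr r1; rewrite split0 /= mon_val0 normr1.
set S := \sum_(g | _) _ => hS.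
rewrite (pval_sum x df) split0 /= mon_val0 mulr1.
set F := \sum_(g | _) _.
(* Exchanging [tr (B_g G)] for [f_g] costs at most [eps |x^g|] for each nonzero [g]. *)
have HFS : H <= F + eps * S.
  rewrite /H /F /S mulr_sumr -big_split /=; apply: ler_sum => g g0.
  rewrite -lerBlDl -mulrBl (le_trans (ler_norm _)) // normrM ler_wpM2r //.
  exact: hG.
have r1' : 0 < 1 - r by rewrite subr_gt0.
(* The bound on the full monomial sum loses 1 when the term [g = 0] is removed. *)
have rE : r / (1 - r) = (1 - r)^-1 - 1 by field; rewrite gt_eqF.
have : eps * S <= eps * (r / (1 - r)).
  by rewrite (ler_pM2l eps_gt0) rE; lra.
rewrite mulrDr mulr1; lra.
Qed.

End UnconCorrectness.

(** * The error bound for the returned value *)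

Unset Implicit Arguments.

Theorem theorem1 (R : realType) (n k : nat) (f : {mpoly R[n]}) (eps lower r : R)
    (mu : {measure set (n.-tuple R) -> \bar R}) (a : n.-tuple R) (lam_eps : R)
    (eps_gt0 : 0 < eps)
    (f_deg : deg_le f (2 * k))
    (lower_le : (lower%:E <= sos_value k f)%E)
    (mu_moments : has_moments mu (2 * k)%N)
    (mu_pos : 0 < lambda_min (measure_moment_mx mu k))
    (mu_bound : (\int[mu]_x (pval f x - lower)) /
                  lambda_min (measure_moment_mx mu k) <= 1)
    (duality : strong_duality k f)
    (bs_input : uncon_lmin f a < uncon_lmax f lower)
    (run : UNCON k f eps lower a lam_eps)
    (relax_exact : sos_value k f = inf_value f)
    (r_gt0 : 0 < r) (r_lt1 : r < 1)
    (minimizer_in_ball : exists2 x : n.-tuple R,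
       minimizer f x & \sum_(i < n) `|tnth x i| <= r) :
  (0 <= lam_eps%:E - inf_value f <= (eps * (2 + r / (1 - r)))%:E)%E.
Proof.
have [_ [l [G [/symmetricmxP sG pG] hG] lE] _] := duality.
have [x xmin xr] := minimizer_in_ball.
have infE : inf_value f = (pval f x)%:E.
  apply/eqP; rewrite eq_le; apply/andP; split.
    by apply: ereal_inf_lbound; exists x.
  by apply: le_ereal_inf_tmp => _ [z _ <-]; rewrite lee_fin.
(* Duality supplies an attained optimum [l], and exactness identifies it with the minimum of [f]. *)
have lx : l = pval f x by apply: EFin_inj; rewrite lE relax_exact.
have lower_l : lower <= l by rewrite -lee_fin lE.
have coef := sos_coef hG.
have tG : \tr G <= 1 by exact: (sos_trace_le1 mu_moments f_deg lower_l).
have [out run_out ->] := run.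
have [] := BS_bounds (opt := f@_(@mnm0 n) - l) (slack := eps * (1 + r / (1 - r)))
  _ _ eps_gt0 bs_input run_out.
- by have := HU_false_le eps_gt0 pG tG coef.
- move=> lam; rewrite lx; exact: (HU_true_ge eps_gt0 f_deg xr r_lt1).
- by rewrite /uncon_lmin lx lerD2l lerN2.
- rewrite /uncon_lmax; have : 0 <= eps * (1 + r / (1 - r)).
    by rewrite mulr_ge0 ?ltW // ltr_pwDl // divr_ge0 ?ltW // subr_gt0.
  lra.
(* The slack [eps (1 + r / (1 - r))] of the answers and the resolution [eps] of the search add up to
   the claimed error. *)
rewrite infE -EFinB !lee_fin lx mulrDr mulr1 [eps * (2 + _)]mulrDr.
move: (eps * _) => e; lra.
Qed.
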